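(* Let $\psi\colon\mathbb{D}\to\mathbb{C}$ be analytic, let $\varphi\colon\mathbb{D}\to\mathbb{D}$ be analytic, and let $X$ be a complex Banach space. Suppose that $E_1$ and $E_2$ are Banach spaces of analytic functions $\mathbb{D}\to\mathbb{C}$ such that, for $E=E_1$ and $E=E_2$: (b1) $E$ contains the constant functions, and (b2) the closed unit ball $B_E$ of $E$ is compact in the compact open topology of $\mathbb{D}$. Let $W_{\psi,\varphi}$ and $\widetilde{W}_{\psi,\varphi}$ denote the weighted composition operators $f\mapsto\psi\cdot(f\circ\varphi)$ acting on scalar-valued and on $X$-valued analytic functions, respectively. (1) If $W_{\psi,\varphi}\colon E_1\to E_2$ is bounded, then $\widetilde{W}_{\psi,\varphi}\colon wE_1(X)\to wE_2(X)$ is bounded. (2) If $X$ is reflexive and $W_{\psi,\varphi}\colon E_1\to E_2$ is compact, then $\widetilde{W}_{\psi,\varphi}$ is weakly compact $wE_1(X)\to wE_2(X)$.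
   Context: $\mathbb{D}$ is the open unit disc in $\mathbb{C}$; $H(\mathbb{D},X)$ is the space of analytic functions $\mathbb{D}\to X$. The weighted composition operator is $f\mapsto\psi\cdot(f\circ\varphi)$, i.e. $z\mapsto\psi(z)f(\varphi(z))$; it is written $W_{\psi,\varphi}$ on $H(\mathbb{D},\mathbb{C})$ and $\widetilde{W}_{\psi,\varphi}$ on $H(\mathbb{D},X)$. Saying that it is bounded (compact, weakly compact) between two spaces means that it maps the first into the second and is a bounded (compact, weakly compact) linear operator between them. For a Banach space $E$ of analytic functions on $\mathbb{D}$ satisfying (b1) and (b2), the weak vector-valued space $wE(X)$ is the Banach space of all $f\in H(\mathbb{D},X)$ such that $$\|f\|_{wE(X)}=\sup_{\|x^*\|_{X^*}\le 1}\|x^*\circ f\|_E<\infty$$ (in particular $x^*\circ f\in E$ for every $x^*\in X^*$). *)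

(* Defs.v *)
From HB Require Import structures.
From mathcomp Require Import all_boot all_order all_algebra.
From mathcomp Require Import complex.
From mathcomp Require Import all_classical all_reals all_analysis.

Set Implicit Arguments.
Unset Strict Implicit.
Unset Printing Implicit Defensive.

Import Order.TTheory GRing.Theory Num.Theory.
Import numFieldNormedType.Exports.

Local Open Scope classical_set_scope.
Local Open Scope ring_scope.
Local Open Scope complex_scope.

(* The regular algebra carries the normed topology of the complex field. *)
Notation Cplx R := (R[i]^o).

Section RealNorm.
Context {R : realType} {V : normedModType R[i]}.

(* Norms take values in R[i]; suprema are taken in R. *)
Definition rnorm (x : V) : R := complex.Re `|x|.

Lemma rnormE (x : V) : `|x| = (rnorm x)%:C.
Proof. by rewrite /rnorm RRe_real// ger0_real. Qed.

Lemma rnorm_ge0 (x : V) : 0 <= rnorm x.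
Proof. by rewrite -ler0c -rnormE. Qed.

Lemma rnorm0 : rnorm 0 = 0.
Proof. by rewrite /rnorm normr0. Qed.

Lemma rnorm_eq0 (x : V) : rnorm x = 0 -> x = 0.
Proof. by move=> x0; apply/normr0_eq0; rewrite rnormE x0. Qed.

Lemma rnormD (x y : V) : rnorm (x + y) <= rnorm x + rnorm y.
Proof. by rewrite -lecR rmorphD/= -!rnormE ler_normD. Qed.

Lemma rnormZ (a : R[i]) (x : V) : rnorm (a *: x) = complex.Re `|a| * rnorm x.
Proof.
apply: (@complexI R); rewrite rmorphM/= -!rnormE normrZ.
by congr (_ * _); rewrite RRe_real// ger0_real.
Qed.

Lemma rnormN (x : V) : rnorm (- x) = rnorm x.
Proof. by rewrite /rnorm normrN. Qed.

Lemma rnormZr (t : R) (x : V) : rnorm (t%:C *: x) = `|t| * rnorm x.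
Proof. by rewrite rnormZ normc_def/= expr0n/= addr0 sqrtr_sqr. Qed.

Lemma le_rnorm1 (x : V) : (`|x| <= 1) = (rnorm x <= 1).
Proof. by rewrite rnormE lecR. Qed.

Definition unit_ball : set V := [set x | `|x| <= 1].

End RealNorm.


Section Dual.
Context {R : realType} (V : normedModType R[i]).

Definition dual_pred : {pred V -> Cplx R} :=
  fun l => `[< linear l /\ continuous l >].

Lemma dual_submod : subsemimod_closed dual_pred.
Proof.
split; [split|].
- apply/asboolP; split; last by move=> x; exact: cvg_cst.
  by move=> a x y; rewrite -[LHS]/0 -[RHS]/(a *: 0 + 0) scaler0 addr0.
- move=> l m /asboolP[ll cl] /asboolP[lm cm]; apply/asboolP; split.
    move=> a x y; rewrite -[LHS]/(l _ + m _) ll lm.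
    by rewrite -[RHS]/(a *: (l x + m x) + (l y + m y)) scalerDr addrACA.
  by move=> x; apply: cvgD; [exact: cl|exact: cm].
- move=> a l /asboolP[ll cl]; apply/asboolP; split.
    move=> b x y; rewrite -[LHS]/(a *: l _) ll.
    by rewrite -[RHS]/(b *: (a *: l x) + a *: l y) scalerDr !scalerA mulrC.
  by move=> x; apply: cvgZr; exact: cl.
Qed.

HB.instance Definition _ :=
  GRing.isSubmodClosed.Build R[i] (V -> Cplx R) dual_pred dual_submod.

Record dual := Dual { dual_val :> V -> Cplx R; _ : dual_val \in dual_pred }.

HB.instance Definition _ := [isSub for dual_val].
HB.instance Definition _ := [Choice of dual by <:].
HB.instance Definition _ := [SubChoice_isSubLmodule of dual by <:].

Lemma dual_linear (l : dual) : linear l.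
Proof. by case: l => l /= /asboolP[]. Qed.

Lemma dual_continuous (l : dual) : continuous l.
Proof. by case: l => l /= /asboolP[]. Qed.

HB.instance Definition _ (l : dual) :=
  GRing.isLinear.Build R[i] V (Cplx R) *:%R (dual_val l) (dual_linear l).

Lemma dual_bounded (l : dual) :
  exists2 M : R, 0 <= M & forall x, rnorm (l x) <= M * rnorm x.
Proof.
have /linear_bounded_continuous/linear_boundedP := @dual_continuous l.
move=> /pinfty_ex_gt0[r r0 lr]; exists (complex.Re r).
  by rewrite -ler0c RRe_real ?gtr0_real// ltW.
move=> x; rewrite -lecR -rnormE rmorphM/= -rnormE RRe_real ?gtr0_real//.
exact: lr.
Qed.

Lemma dual_predP (l : V -> Cplx R) (M : R) : linear l ->
  (forall x, rnorm (l x) <= M * rnorm x) -> l \in dual_pred.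
Proof.
move=> ll lM; apply/asboolP; split => //.
pose L : {linear V -> Cplx R} := HB.pack l (GRing.isLinear.Build _ _ _ _ l ll).
apply: (@bounded_linear_continuous _ _ _ L); apply/bounded_funP => r.
exists ((`|M| * complex.Re r)%:C) => x /= xr; rewrite rnormE lecR.
have xr' : rnorm x <= complex.Re r by move: xr; rewrite lecE => /andP[].
rewrite (le_trans (lM x))// (@le_trans _ _ (`|M| * rnorm x))//.
  by rewrite ler_wpM2r ?rnorm_ge0// ler_norm.
by rewrite ler_wpM2l.
Qed.

Definition dual_norm (l : dual) : R := sup [set rnorm (l x) | x in unit_ball].

Lemma unit_ball0 : unit_ball (0 : V).
Proof. by rewrite /unit_ball/= normr0. Qed.

Lemma dual_norm_le (l : dual) (M : R) : 0 <= M ->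
  (forall x, rnorm (l x) <= M * rnorm x) -> dual_norm l <= M.
Proof.
move=> M0 lM; apply: ge_sup.
  by exists (rnorm (l 0)); exists 0 => //; exact: unit_ball0.
move=> _ [x + <-]; rewrite /unit_ball/= le_rnorm1 => x1.
by rewrite (le_trans (lM x))// ler_piMr.
Qed.

Lemma dual_normP (l : dual) (x : V) : rnorm (l x) <= dual_norm l * rnorm x.
Proof.
have [->|x0] := eqVneq x 0; first by rewrite linear0 !rnorm0 mulr0.
have rx0 : 0 < rnorm x.
  rewrite lt_neqAle rnorm_ge0 andbT eq_sym.
  by apply: contra_neq x0; exact: rnorm_eq0.
have xr : rnorm (((rnorm x)^-1)%:C *: x) = 1.
  by rewrite rnormZr gtr0_norm ?invr_gt0// mulVf ?gt_eqF.
have : rnorm (l (((rnorm x)^-1)%:C *: x)) <= dual_norm l.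
  apply: ub_le_sup; last first.
    by exists (((rnorm x)^-1)%:C *: x) => //; rewrite /unit_ball/= le_rnorm1 xr.
  have [M M0 lM] := dual_bounded l; exists M => _ [y + <-].
  by rewrite /unit_ball/= le_rnorm1 => y1; rewrite (le_trans (lM y))// ler_piMr.
rewrite linearZ/= rnormZr gtr0_norm ?invr_gt0//.
by rewrite mulrC ler_pdivrMr.
Qed.

Lemma dual_norm_ge0 (l : dual) : 0 <= dual_norm l.
Proof.
have [M M0 lM] := dual_bounded l.
apply: (@le_trans _ _ (rnorm (l 0))); first exact: rnorm_ge0.
apply: ub_le_sup; last by exists 0 => //; exact: unit_ball0.
exists M => _ [y + <-].
by rewrite /unit_ball/= le_rnorm1 => y1; rewrite (le_trans (lM y))// ler_piMr.
Qed.

Lemma dual_normD (l m : dual) : dual_norm (l + m) <= dual_norm l + dual_norm m.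
Proof.
apply: dual_norm_le => [|x]; first by rewrite addr_ge0 ?dual_norm_ge0.
by rewrite -[(l + m) x]/(l x + m x) (le_trans (rnormD _ _))// mulrDl lerD
  ?dual_normP.
Qed.

Lemma ReN_ge0 (a : R[i]) : 0 <= complex.Re `|a|.
Proof. by rewrite -ler0c RRe_real// ger0_real. Qed.

Lemma dual_normZ (a : R[i]) (l : dual) :
  dual_norm (a *: l) = complex.Re `|a| * dual_norm l.
Proof.
have le b (m : dual) : dual_norm (b *: m) <= complex.Re `|b| * dual_norm m.
  apply: dual_norm_le => [|x]; first by rewrite mulr_ge0 ?dual_norm_ge0 ?ReN_ge0.
  rewrite -[(b *: m) x]/(b *: m x) rnormZ -mulrA ler_wpM2l ?ReN_ge0//.
  exact: dual_normP.
apply/eqP; rewrite eq_le le andTb.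
have [->|a0] := eqVneq a 0.
  by rewrite normr0 mul0r dual_norm_ge0.
have ra0 : 0 < complex.Re `|a|.
  by rewrite -ltcR RRe_real ?ger0_real// normr_gt0.
rewrite -ler_pdivlMl// -[l in leLHS](scalerK a0).
rewrite (le_trans (le _ _))// le_eqVlt; apply/orP; left; apply/eqP; congr (_ * _).
apply: (@complexI R); rewrite fmorphV.
rewrite -[RHS]/((complex.Re `|a|)%:C^-1) !RRe_real ?ger0_real//.
exact: normfV.
Qed.

Lemma dual_norm_eq0 (l : dual) : dual_norm l = 0 -> l = 0.
Proof.
move=> l0; apply/val_inj/funext => x; apply: rnorm_eq0.
by apply/eqP; rewrite eq_le rnorm_ge0 andbT (le_trans (dual_normP l x))// l0 mul0r.
Qed.

Let normC (l : dual) : R[i] := (dual_norm l)%:C.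

Let ler_normCD l m : normC (l + m) <= normC l + normC m.
Proof. by rewrite /normC -rmorphD/= lecR dual_normD. Qed.

Let normCZ a l : normC (a *: l) = `|a| * normC l.
Proof.
by rewrite /normC dual_normZ (rmorphM (real_complex R)).
Qed.

Let normC_eq0 l : normC l = 0 -> l = 0.
Proof. by move/(@complexI R); exact: dual_norm_eq0. Qed.

HB.instance Definition _ :=
  Lmodule_isNormed.Build R[i] dual ler_normCD normCZ normC_eq0.

Lemma rnorm_dual (l : dual) : rnorm l = dual_norm l.
Proof. by []. Qed.

End Dual.

Section HahnBanach.
Context {R : realType} {V : normedModType R[i]} (v : V).
Implicit Types (p q : V * R) (A : set (V * R)).

Let line : set (V * R) := [set p | exists t : R, p = (t%:C *: v, t * rnorm v)].

Let dominated A := [/\ forall p q, A p -> A q -> A (p.1 + q.1, p.2 + q.2),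
  forall t p, A p -> A (t%:C *: p.1, t * p.2) &
  forall p, A p -> p.2 <= rnorm p.1].

Let line_dominated : dominated line.
Proof.
split.
- move=> _ _ [s ->] [t ->]; exists (s + t).
  by rewrite /= rmorphD/= scalerDl mulrDl.
- by move=> s _ [t ->]; exists (s * t); rewrite /= rmorphM/= scalerA mulrA.
- move=> _ [t ->] /=; rewrite rnormZr.
  by rewrite ler_wpM2r ?rnorm_ge0// ler_norm.
Qed.

Let maximal_dominated : exists A, [/\ dominated A, line `<=` A &
  forall B, dominated B -> A `<=` B -> B `<=` A].
Proof.
have [|A [dA maxA]] := @Zorn_bigcup _ [set A | dominated (line `|` A)].
  move=> F FP totF.
  have sub X : F X -> line `|` X `<=` line `|` \bigcup_(Y in F) Y.
    by move=> FX p [?|Xp]; [left|right; exists X].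
  have ext2 p q : (line `|` \bigcup_(Y in F) Y) p ->
      (line `|` \bigcup_(Y in F) Y) q -> exists X, [/\ dominated X,
      X `<=` line `|` \bigcup_(Y in F) Y, X p & X q].
    move=> [lp|[X FX Xp]] [lq|[Y FY Yq]].
    - by exists line; split => //; exact: subsetUl.
    - by exists (line `|` Y); split; [exact: FP|exact: sub|left|right].
    - by exists (line `|` X); split; [exact: FP|exact: sub|right|left].
    - have [XY|YX] := totF _ _ FX FY.
        by exists (line `|` Y); split; [exact: FP|exact: sub|right;exact: XY|right].
      by exists (line `|` X); split; [exact: FP|exact: sub|right|right;exact: YX].
  split.
  - move=> p q Ap Aq; have [X [[+ _ _] XA Xp Xq]] := ext2 _ _ Ap Aq.
    by move=> dX; apply: XA; exact: dX.
  - move=> t p Ap; have [X [[_ + _] XA Xp _]] := ext2 _ _ Ap Ap.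
    by move=> dX; apply: XA; exact: dX.
  - move=> p Ap; have [X [[_ _ +] XA Xp _]] := ext2 _ _ Ap Ap.
    exact.
exists (line `|` A); split => // B dB AB; apply: contrapT => nBA.
apply: (maxA B); last by rewrite /mkset setUidr//; move=> p ?; apply: AB; left.
split; first by move=> p Ap; apply: AB; right.
by move=> BA; apply: nBA => p /BA; right.
Qed.

Let real_extension : exists u : V -> R, [/\ forall x y, u (x + y) = u x + u y,
  forall (t : R) x, u (t%:C *: x) = t * u x,
  forall x, u x <= rnorm x & u v = rnorm v].
Proof.
have [A [dA lA maxA]] := maximal_dominated.
have [AD AZ Ale] := dA.
have A0 : A (0, 0) by apply: lA; exists 0; rewrite scale0r mul0r.
have tot x0 : exists c, A (x0, c).
  pose S := [set p.2 - rnorm (p.1 - x0) | p in A].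
  have Sub q : A q -> ubound S (rnorm (q.1 + x0) - q.2).
    move=> Aq _ [p Ap <-]; rewrite lerBrDr addrAC lerBlDr.
    rewrite (le_trans (Ale _ (AD _ _ Ap Aq)))//=.
    rewrite [leRHS]addrC (le_trans _ (rnormD _ _))//.
    by rewrite addrACA addNr addr0.
  have S0 : S !=set0 by exists (0 - rnorm (0 - x0)), (0, 0).
  pose c := sup S.
  have c1 p : A p -> p.2 - rnorm (p.1 - x0) <= c.
    by move=> Ap; apply: ub_le_sup; [exists (rnorm (0 + x0) - 0); exact: (Sub _ A0)|exists p].
  have c2 q : A q -> c <= rnorm (q.1 + x0) - q.2.
    by move=> Aq; apply: ge_sup => //; exact: Sub.
  pose B := [set r : V * R | exists t p, A p /\
    r = (p.1 + t%:C *: x0, p.2 + t * c)].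
  have dB : dominated B.
    split.
    - move=> _ _ [s [p [Ap ->]]] [t [q [Aq ->]]].
      exists (s + t), (p.1 + q.1, p.2 + q.2); split; first exact: AD.
      by rewrite /= rmorphD/= scalerDl mulrDl addrACA [in X in (_, X)]addrACA.
    - move=> s _ [t [p [Ap ->]]].
      exists (s * t), (s%:C *: p.1, s * p.2); split; first exact: AZ.
      by rewrite /= rmorphM/= scalerDr scalerA mulrDr mulrA.
    - move=> _ [t [p [Ap ->]]] /=.
      have [t0|t0|->] := ltgtP t 0; last first.
      + by rewrite scale0r mul0r !addr0; exact: Ale.
      + have := c2 _ (AZ t^-1 p Ap); rewrite /= lerBrDr -(ler_pM2l t0) mulrDr.
        rewrite mulrA mulfV ?gt_eqF// mul1r addrC => /le_trans; apply.
        rewrite -{1}(gtr0_norm t0) -rnormZr scalerDr scalerA -rmorphM/=.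
        by rewrite mulfV ?gt_eqF// rmorph1 scale1r.
      + have nt0 : 0 < - t by rewrite oppr_gt0.
        have := c1 _ (AZ (- t)^-1 p Ap).
        rewrite /= lerBlDr -(ler_pM2l nt0) mulrDr mulrA mulfV ?gt_eqF// mul1r.
        rewrite mulNr -lerBlDl opprK => /le_trans; apply.
        rewrite -{1}(gtr0_norm nt0) -rnormZr scalerDr scalerA -rmorphM/=.
        by rewrite mulfV ?gt_eqF// rmorph1 scale1r scalerN rmorphN/= scaleNr opprK.
  exists c; apply: (maxA B dB).
    by move=> p Ap; exists 0, p; split => //; rewrite scale0r mul0r !addr0; case: p Ap.
  by exists 1, (0, 0); split => //=; rewrite rmorph1 scale1r mul1r !add0r.
have uniq x a b : A (x, a) -> A (x, b) -> a = b.
  have sub y c d : A (y, c) -> A (y, d) -> c <= d.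
    move=> Ac Ad; have := Ale _ (AD _ _ Ac (AZ (-1) _ Ad)).
    by rewrite /= rmorphN1 scaleN1r subrr rnorm0 mulN1r subr_le0.
  by move=> Aa Ab; apply/eqP; rewrite eq_le !(sub x).
have [u Au] := choice tot.
exists u; split.
- by move=> x y; apply: (uniq (x + y)) => //; exact: (AD _ _ (Au x) (Au y)).
- by move=> t x; apply: (uniq (t%:C *: x)) => //; exact: (AZ t _ (Au x)).
- by move=> x; exact: (Ale _ (Au x)).
- by apply: (uniq v) => //; apply: lA; exists 1; rewrite rmorph1 scale1r mul1r.
Qed.

Lemma hahn_banach : v != 0 -> exists2 l : dual V, `|l| <= 1 & l v != 0.
Proof.
move=> v0; have [u [uD uZ ule uv]] := real_extension.
pose l : V -> Cplx R := fun x => u x +i* (- u ('i%C *: x)).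
have uN x : u (- x) = - u x.
  by rewrite -scaleN1r -(rmorphN1 (real_complex R)) uZ mulN1r.
have scE (a : R[i]) x :
    a *: x = (complex.Re a)%:C *: x + (complex.Im a)%:C *: ('i%C *: x).
  by rewrite scalerA -scalerDl [a in LHS]complexE mulrC [in X in _ + X]mulrC.
have uE (a : R[i]) x :
    u (a *: x) = complex.Re a * u x + complex.Im a * u ('i%C *: x).
  by rewrite scE uD !uZ.
have uii x : u ('i%C *: ('i%C *: x)) = - u x.
  rewrite -uN; congr (u _); rewrite scalerA -scaleN1r; congr (_ *: _).
  by apply/eqP; rewrite eq_complex /= !mul0r !mulr0 mul1r !add0r oppr0 !eqxx.
have uiE (a : R[i]) x :
    u ('i%C *: (a *: x)) = complex.Re a * u ('i%C *: x) - complex.Im a * u x.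
  have -> : 'i%C *: (a *: x) = a *: ('i%C *: x) by rewrite !scalerA mulrC.
  by rewrite uE uii mulrN.
have ll : linear l.
  move=> a x y; rewrite /l scalerDr (uD (a *: x)) (uD ('i%C *: (a *: x))).
  rewrite uiE (uE a); case: a => p q /=.
  apply/eqP; rewrite eq_complex; apply/andP; split; apply/eqP => /=.
    by rewrite mulrN opprK.
  by rewrite !mulrN !opprD opprK.
have lle x : rnorm (l x) <= 1 * rnorm x.
  rewrite mul1r; have [l0|l0] := eqVneq (l x) 0.
    by rewrite l0 rnorm0 rnorm_ge0.
  have rl0 : 0 < rnorm (l x).
    by rewrite -ltcR -rnormE normr_gt0.
  have := ule (((l x)^*)%C *: x).
  rewrite rnormZ.
  have -> : complex.Re `|((l x)^*)%C| = rnorm (l x) by rewrite normcJ.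
  suff -> : u (((l x)^*)%C *: x) = rnorm (l x) * rnorm (l x).
    by rewrite ler_pM2l.
  have -> : rnorm (l x) = Num.sqrt (u x ^+ 2 + u ('i%C *: x) ^+ 2).
    by rewrite /rnorm normc_def /= sqrrN.
  by rewrite -[RHS]expr2 sqr_sqrtr ?addr_ge0 ?sqr_ge0// uE /= opprK !expr2.
exists (Dual (dual_predP ll lle)).
  by rewrite le_rnorm1 rnorm_dual; exact: dual_norm_le.
apply/eqP => /(congr1 (@complex.Re R)) /=; rewrite uv => /rnorm_eq0.
by apply/eqP.
Qed.

End HahnBanach.

Section Analytic.
Context {R : realType}.

Definition disc : set (Cplx R) := [set z | `|z| < 1].

(* The disc is open, so the extension by zero outside the disc does not affect *)
(* complex differentiability at its points.                                    *)
Definition analytic (X : normedModType R[i]) (f : disc -> X) : Prop :=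
  forall z : disc, derivable ('valL_ (0 : X) f) (val z) (1 : Cplx R).

Lemma analytic0 (X : normedModType R[i]) : analytic (0 : disc -> X).
Proof.
move=> z; rewrite (_ : 'valL_ _ _ = cst 0); first exact: derivable_cst.
by apply/funext => w; rewrite /valL_/=; case: ('oinv_set_val w).
Qed.

Lemma analyticD (X : normedModType R[i]) (f g : disc -> X) :
  analytic f -> analytic g -> analytic (f + g).
Proof.
move=> hf hg z.
rewrite (_ : 'valL_ _ _ = 'valL_ (0 : X) f + 'valL_ (0 : X) g).
  by apply: derivableD; [exact: hf|exact: hg].
apply/funext => w; rewrite -[RHS]/('valL_ (0 : X) f w + 'valL_ (0 : X) g w).
by rewrite /valL_/=; case: ('oinv_set_val w) => //=; rewrite addr0.
Qed.

Lemma analyticZ (X : normedModType R[i]) (a : R[i]) (f : disc -> X) :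
  analytic f -> analytic (a *: f).
Proof.
move=> hf z.
rewrite (_ : 'valL_ _ _ = a *: 'valL_ (0 : X) f).
  by apply: derivableZ; exact: hf.
apply/funext => w; rewrite -[RHS]/(a *: 'valL_ (0 : X) f w).
by rewrite /valL_/=; case: ('oinv_set_val w) => //=; rewrite scaler0.
Qed.

End Analytic.
Arguments disc : clear implicits.

(* The linear injection af_fun identifies the space with a subspace of the     *)
(* analytic functions.                                                         *)
Record analyticBanachSpace (R : realType) := AnalyticBanachSpace {
  af_space :> completeNormedModType R[i] ;
  af_fun : {linear af_space -> (disc R -> Cplx R)} ;
  af_inj : injective af_fun ;
  af_analytic : forall f, analytic (af_fun f) }.

Section WeakSpace.
Context {R : realType} (E : analyticBanachSpace R) (X : normedModType R[i]).
Local Open Scope ereal_scope.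

(* Equal to +oo when g is not (the function of) an element of E. *)
Definition af_norm (g : disc R -> Cplx R) : \bar R :=
  ereal_inf [set (rnorm h)%:E | h in [set h : E | af_fun E h = g]].

Definition weak_norm (f : disc R -> X) : \bar R :=
  ereal_sup [set af_norm (l \o f) | l in @unit_ball R (dual X)].

Definition wspace_pred : {pred disc R -> X} :=
  fun f => `[< analytic f /\ weak_norm f < +oo >].

Lemma af_normE (h : E) : af_norm (af_fun E h) = (rnorm h)%:E.
Proof.
rewrite /af_norm (_ : [set h' | _] = [set h]) ?image_set1 ?ereal_inf1//.
by apply/seteqP; split => [h' /= /af_inj|h' ->].
Qed.

Lemma af_norm_fin (g : disc R -> Cplx R) : af_norm g < +oo ->
  exists h : E, af_fun E h = g.
Proof.
move=> goo; apply: contrapT => nh; move: goo; rewrite /af_norm.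
rewrite (_ : [set h' | _] = set0) ?image_set0 ?ereal_inf0// -subset0 => h /= hg.
by apply: nh; exists h.
Qed.

Lemma af_norm_ge0 (g : disc R -> Cplx R) : 0 <= af_norm g.
Proof. by apply: le_ereal_inf_tmp => _ [h _ <-]; rewrite lee_fin rnorm_ge0. Qed.

Lemma af_normD (g1 g2 : disc R -> Cplx R) :
  af_norm (g1 + g2)%R <= af_norm g1 + af_norm g2.
Proof.
have [/af_norm_fin[h1 <-]|] := ltP (af_norm g1) +oo; last first.
  rewrite leye_eq => /eqP ->; rewrite addye ?leey//.
  by rewrite gt_eqF// (lt_le_trans _ (af_norm_ge0 _)).
have [/af_norm_fin[h2 <-]|] := ltP (af_norm g2) +oo; last first.
  rewrite leye_eq => /eqP ->; rewrite addey ?leey//.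
  by rewrite gt_eqF// (lt_le_trans _ (af_norm_ge0 _)).
by rewrite -linearD !af_normE -EFinD lee_fin rnormD.
Qed.

Lemma af_normZ (a : R[i]) (g : disc R -> Cplx R) : af_norm g < +oo ->
  af_norm (a *: g)%R = (complex.Re `|a|)%:E * af_norm g.
Proof.
by move=> /af_norm_fin[h <-]; rewrite -linearZ !af_normE rnormZ EFinM.
Qed.

Lemma weak_norm_ub (f : disc R -> X) (l : dual X) : (`|l| <= 1)%R ->
  af_norm (l \o f) <= weak_norm f.
Proof. by move=> l1; apply: ereal_sup_ubound; exists l. Qed.

Lemma weak_norm_ge0 (f : disc R -> X) : 0 <= weak_norm f.
Proof.
apply: le_trans (af_norm_ge0 _) (@weak_norm_ub f 0%R _).
by rewrite normr0.
Qed.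

Lemma weak_norm0 : weak_norm 0%R = 0.
Proof.
apply/eqP; rewrite eq_le weak_norm_ge0 andbT.
apply: ub_ereal_sup => _ [l _ <-].
rewrite (_ : _ \o _ = af_fun E 0%R); first by rewrite af_normE rnorm0.
by rewrite linear0; apply/funext => z /=; exact: linear0.
Qed.

Lemma weak_normD (f g : disc R -> X) :
  weak_norm (f + g)%R <= weak_norm f + weak_norm g.
Proof.
apply: ub_ereal_sup => _ [l l1 <-].
rewrite (_ : _ \o _ = (l \o f) + (l \o g))%R; last first.
  by apply/funext => z /=; exact: linearD.
by apply: le_trans (af_normD _ _) _; apply: leeD; exact: weak_norm_ub.
Qed.

Lemma weak_normZ_le (a : R[i]) (f : disc R -> X) : weak_norm f < +oo ->
  weak_norm (a *: f)%R <= (complex.Re `|a|)%:E * weak_norm f.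
Proof.
move=> foo; apply: ub_ereal_sup => _ [l l1 <-].
rewrite (_ : _ \o _ = a *: (l \o f))%R; last first.
  by apply/funext => z /=; exact: linearZ.
rewrite af_normZ; last by rewrite (le_lt_trans _ foo)// weak_norm_ub.
by rewrite lee_wpmul2l ?lee_fin ?ReN_ge0// weak_norm_ub.
Qed.

Lemma wspace_submod : subsemimod_closed wspace_pred.
Proof.
split; [split|].
- by apply/asboolP; rewrite weak_norm0; split => //; exact: analytic0.
- move=> f g /asboolP[hf foo] /asboolP[hg goo]; apply/asboolP; split.
    exact: analyticD.
  by rewrite (le_lt_trans (weak_normD _ _))// lte_add_pinfty.
- move=> a f /asboolP[hf foo]; apply/asboolP; split; first exact: analyticZ.
  rewrite (le_lt_trans (weak_normZ_le _ foo))//.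
  by rewrite lte_mul_pinfty// lee_fin ReN_ge0.
Qed.

HB.instance Definition _ :=
  GRing.isSubmodClosed.Build R[i] (disc R -> X) wspace_pred wspace_submod.

Record wspace :=
  WSpace { wspace_fun :> disc R -> X; _ : wspace_fun \in wspace_pred }.

HB.instance Definition _ := [isSub for wspace_fun].
HB.instance Definition _ := [Choice of wspace by <:].
HB.instance Definition _ := [SubChoice_isSubLmodule of wspace by <:].

Lemma wspace_lty (f : wspace) : weak_norm f < +oo.
Proof. by case: f => f /= /asboolP[]. Qed.

Lemma wspace_analytic (f : wspace) : analytic f.
Proof. by case: f => f /= /asboolP[]. Qed.

Lemma weak_norm_fin_num (f : wspace) : weak_norm f \is a fin_num.
Proof. by rewrite ge0_fin_numE ?wspace_lty// weak_norm_ge0. Qed.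

Local Open Scope ring_scope.

Let norm (f : wspace) : R[i] := (fine (weak_norm f))%:C.

Let ler_normD f g : norm (f + g) <= norm f + norm g.
Proof.
rewrite /norm -rmorphD/= lecR -lee_fin EFinD !fineK ?weak_norm_fin_num//.
  exact: weak_normD.
exact: (weak_norm_fin_num (f + g)).
Qed.

Let norm_ge0 f : 0 <= fine (weak_norm f).
Proof. by rewrite fine_ge0 ?weak_norm_ge0. Qed.

Let normZ a f : norm (a *: f) = `|a| * norm f.
Proof.
have le b (g : wspace) :
    fine (weak_norm (b *: g)) <= complex.Re `|b| * fine (weak_norm g).
  rewrite -lee_fin EFinM !fineK ?weak_norm_fin_num//.
  exact/weak_normZ_le/wspace_lty.
have -> : `|a| = (complex.Re `|a|)%:C by [].
rewrite /norm -(rmorphM (real_complex R)); congr (_%:C).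
apply/eqP; rewrite eq_le le andTb.
have [->|a0] := eqVneq a 0; first by rewrite normr0 mul0r.
have ra0 : 0 < complex.Re `|a|.
  by rewrite -ltcR RRe_real ?ger0_real// normr_gt0.
rewrite -ler_pdivlMl// -[f in leLHS](scalerK a0).
rewrite (le_trans (le _ _))// le_eqVlt; apply/orP; left; apply/eqP; congr (_ * _).
apply: (@complexI R); rewrite fmorphV.
rewrite -[RHS]/((complex.Re `|a|)%:C^-1) !RRe_real ?ger0_real//.
exact: normfV.
Qed.

Let norm_eq0 f : norm f = 0 -> f = 0.
Proof.
move=> /(@complexI R) f0; apply/val_inj/funext => z /=.
apply: contrapT => /eqP /hahn_banach[l l1 /eqP]; apply.
have wf0 : weak_norm f = 0%E by rewrite -(fineK (weak_norm_fin_num f)) f0.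
have lf0 : (af_norm (l \o f) <= 0)%E by rewrite -wf0 weak_norm_ub.
have [|h hl] := @af_norm_fin (l \o f); first exact: le_lt_trans lf0 _.
move: lf0; rewrite -hl af_normE lee_fin => h0.
have /rnorm_eq0 h00 : rnorm h = 0 by apply/eqP; rewrite eq_le h0 rnorm_ge0.
by rewrite -[LHS]/((l \o f) z) -hl h00 linear0.
Qed.

HB.instance Definition _ :=
  Lmodule_isNormed.Build R[i] wspace ler_normD normZ norm_eq0.

Lemma rnorm_wspace (f : wspace) : rnorm f = fine (weak_norm f).
Proof. by []. Qed.

End WeakSpace.

Section WeakTopology.
Context {R : realType} (V : normedModType R[i]).

Definition weak : Type :=
  initial_topology (fun (v : V) => (fun l : dual V => l v) : {ptws dual V -> Cplx R}).

HB.instance Definition _ := Topological.on weak.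

Definition reflexive_space : Prop :=
  forall Phi : dual (dual V), exists v : V, forall l : dual V, Phi l = l v.

End WeakTopology.

Section Operators.
Context {R : realType} {V W : normedModType R[i]}.

Definition bounded_operator (T : {linear V -> W}) : Prop :=
  exists M : R, forall x, `|T x| <= M%:C * `|x|.

Definition compact_operator (T : {linear V -> W}) : Prop :=
  precompact (T @` unit_ball).

Definition weakly_compact_operator (T : {linear V -> W}) : Prop :=
  precompact (T @` unit_ball : set (weak W)).

(* F maps V into W (seen as function spaces through jV and jW) and, as an      *)
(* operator between them, satisfies P.                                         *)
Definition acts_as (P : {linear V -> W} -> Prop) (S Y : Type)
    (F : (S -> Y) -> (S -> Y)) (jV : V -> S -> Y) (jW : W -> S -> Y) : Prop :=
  exists T : {linear V -> W}, (forall f, jW (T f) = F (jV f)) /\ P T.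

End Operators.

Section Main.
Context {R : realType}.

Definition weighted_composition (X : lmodType R[i]) (psi : disc R -> Cplx R)
    (phi : disc R -> disc R) (f : disc R -> X) : disc R -> X :=
  fun z => psi z *: f (phi z).

Definition has_constants (E : analyticBanachSpace R) : Prop :=
  forall c : Cplx R, exists f : E, af_fun E f = cst c.

Definition ball_compact (E : analyticBanachSpace R) : Prop :=
  compact (af_fun E @` unit_ball : set {compact-open, disc R -> Cplx R}).

End Main.

(* Main.v *)
(** Write [W] for the scalar operator, [S] for the vector-valued one. For [f] in
    [wE1(X)] and [l] in [X^*] we have [l \o S f = W (l \o f)], which gives (1).

    For (2) let [A] be the norm closure of [W(B_E1)], a compact symmetric convex
    set. Every [h] in [S(ball)] satisfies [l \o h \in A] whenever [|l| <= 1];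
    let [K] be the set of all [h] in [wE2(X)] with this property. It is enough
    that [K] is weakly compact. Along an ultrafilter on [K] the functions
    [l \o h] converge in [A] for each [l], and reflexivity of [X] provides [g : D -> X]
    with [l \o g] equal to this limit. No complex analysis is needed to see that
    [g] is analytic: difference quotients are equicontinuous on the Banach space
    [E2] by Banach-Steinhaus, hence converge uniformly on the compact set [A], so
    that those of [g] are Cauchy in [X].

    It remains to see that [h -> g] weakly, knowing that [h z -> g z] weakly in
    [X] for each [z]. On the compact set [A] the norm is controlled, up to [e], by
    the values at finitely many points [z]; hence
    [Re (Phi h) <= C \sum_z |h z| + e] on [K] for [Phi] in the dual of [wE2(X)].
    The sandwich form of the Hahn-Banach theorem replaces the right-hand side by
    [\sum_z Re (m_z (h z)) + e] with [m_z] in [X^*], which passes to the limit. *)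

From HB Require Import structures.
Require Import Defs.
From mathcomp Require Import all_boot all_order all_algebra complex.
From mathcomp Require Import lra.
From mathcomp Require Import all_classical all_reals all_analysis.
Import Order.TTheory GRing.Theory Num.Theory.
Import numFieldNormedType.Exports.

Set Implicit Arguments.
Unset Strict Implicit.
Unset Printing Implicit Defensive.

Local Open Scope classical_set_scope.
Local Open Scope ring_scope.
Local Open Scope complex_scope.

(** * Real-linear functionals below sublinear ones *)

Section Sublinear.
Context {R : realType} {V : lmodType R[i]}.
Implicit Types (p q u : V -> R) (C : set (V * R)).

(* Only real scalars matter. The inequality in the second clause is an equality
   for t > 0: apply it to t^-1. *)
Definition sublinear p := (forall x y, p (x + y) <= p x + p y) /\
  (forall (t : R) x, 0 < t -> p (t%:C *: x) <= t * p x).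

Definition real_linear u := (forall x y, u (x + y) = u x + u y) /\
  (forall (t : R) x, u (t%:C *: x) = t * u x).

Lemma real_scalerA (s t : R) (x : V) : s%:C *: (t%:C *: x) = (s * t)%:C *: x.
Proof. by rewrite scalerA -rmorphM. Qed.

Lemma real_scale1r (x : V) : (1 : R)%:C *: x = x.
Proof. by rewrite rmorph1 scale1r. Qed.

Lemma sublinear0 p : sublinear p -> p 0 = 0.
Proof.
move=> [_ ph]; have h2 := ph 2 0 (ltr0n _ 2).
have := ph 2^-1 0; rewrite invr_gt0 ltr0n => /(_ isT).
rewrite !scaler0 in h2 *; rewrite ler_pdivlMl ?ltr0n// => h1.
have h2' : 0 <= p 0 by rewrite -(lerD2r (p 0)) add0r -mulr2n -mulr_natl.
have h1' : p 0 <= 0 by rewrite -(lerD2r (p 0)) add0r -mulr2n -mulr_natl.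
by apply/eqP; rewrite eq_le h1'.
Qed.

Lemma sublinearN p x : sublinear p -> - p (- x) <= p x.
Proof.
move=> sp; rewrite -subr_ge0 opprK.
by rewrite -(sublinear0 sp) -[X in p X](subrr x); exact: sp.1.
Qed.

(* C plays the role of the cone generated by the hypograph of a concave function
   on a convex set. *)
Definition cone_le p C := [/\ C !=set0,
  forall c d, C c -> C d -> C (c.1 + d.1, c.2 + d.2),
  forall (t : R) c, 0 < t -> C c -> C (t%:C *: c.1, t * c.2) &
  forall c, C c -> c.2 <= p c.1].

(** Take for [q x] the infimum of [p (x + c.1) - c.2] over [c] in [C]. It is bounded below by
    [- p (- x)], since [c.2 <= p c.1 <= p (x + c.1) + p (- x)]; the choice [x = - c.1] gives the
    last clause. *)
Lemma sublinear_below_cone p C : sublinear p -> cone_le p C ->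
  exists q, [/\ sublinear q, forall x, q x <= p x &
    forall c, C c -> q (- c.1) <= - c.2].
Proof.
move=> sp [[c0 Cc0] CD CZ Cle].
pose S x := [set p (x + c.1) - c.2 | c in C].
have S0 x : S x !=set0 by exists (p (x + c0.1) - c0.2), c0.
have lbS x : lbound (S x) (- p (- x)).
  move=> _ [c Cc <-]; rewrite lerBrDr addrC lerBlDr.
  rewrite (le_trans (Cle _ Cc))// (le_trans _ (sp.1 _ _))//.
  by rewrite addrAC subrr add0r.
pose q x := inf (S x).
have qle x c : C c -> q x <= p (x + c.1) - c.2.
  by move=> Cc; apply: ge_inf; [exists (- p (- x)); exact: lbS|exists c].
have qge x r : (forall c, C c -> r <= p (x + c.1) - c.2) -> r <= q x.
  by move=> rc; apply: lb_le_inf => // _ [c Cc <-]; exact: rc.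
exists q; split.
- split=> [x y|t x t0].
    rewrite -lerBlDr; apply: (qge) => c Cc; rewrite lerBlDr -lerBlDl.
    apply: (qge) => d Cd; rewrite lerBlDl.
    rewrite (le_trans (qle _ _ (CD _ _ Cd Cc)))//=.
    rewrite [leRHS]addrACA -opprD [c.2 + _]addrC lerB//.
    by rewrite [d.1 + _]addrC addrACA sp.1.
  rewrite mulrC -ler_pdivrMr//; apply: (qge) => c Cc.
  rewrite ler_pdivrMr// (le_trans (qle _ _ (CZ t c t0 Cc)))//=.
  by rewrite mulrBl mulrC [c.2 * t]mulrC lerB// -scalerDr mulrC sp.2.
- move=> x; apply/ler_addgt0Pr => e e0.
  have Cc0le := Cle _ Cc0.
  (* Shrinking [c0] by this factor makes its contribution [t * (p c0.1 - c0.2)] at most [e]. *)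
  pose t := e / (p c0.1 - c0.2 + 1).
  have d0 : 0 < p c0.1 - c0.2 + 1 by rewrite ltr_wpDl// subr_ge0.
  have t0 : 0 < t by rewrite divr_gt0.
  rewrite (le_trans (qle _ _ (CZ t c0 t0 Cc0)))//= lerBlDr.
  rewrite (le_trans (sp.1 _ _))// -addrA lerD2l (le_trans (sp.2 _ _ t0))//.
  rewrite -lerBlDr -mulrBr /t mulrAC ler_pdivrMr//.
  by apply: ler_wpM2l; [exact: ltW|rewrite lerDl].
- by move=> c Cc; rewrite (le_trans (qle _ _ Cc))// addNr (sublinear0 sp) add0r.
Qed.

(** Zorn's lemma for the reversed pointwise order. A nonempty chain has its pointwise infimum as a
    bound, finite because every sublinear [q <= p] satisfies [q x >= - p (- x)]. *)
Lemma minimal_sublinear p : sublinear p ->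
  exists q, [/\ sublinear q, forall x, q x <= p x &
    forall r, sublinear r -> (forall x, r x <= q x) -> forall x, q x <= r x].
Proof.
move=> sp; pose T := {q : V -> R | sublinear q /\ forall x, q x <= p x}.
pose le (q r : T) := `[< forall x, sval r x <= sval q x >].
have tp : sublinear p /\ forall x, p x <= p x by [].
have [|||[q [sq qp]] qmin] := @ZL_preorder T (exist _ p tp) le.
- by move=> q; apply/asboolP.
- move=> r s t /asboolP rs /asboolP st; apply/asboolP => x.
  exact: le_trans (st x) (rs x).
- move=> A totA; have [->|/set0P[q0 Aq0]] := eqVneq A set0.
    by exists (exist _ p tp).
  pose S x := [set sval q x | q in A].
  have lbS x : lbound (S x) (- p (- x)).
    move=> _ [q Aq <-]; have [sq qp] := svalP q.
    by rewrite (le_trans _ (sublinearN _ sq))// lerN2.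
  have S0 x : S x !=set0 by exists (sval q0 x), q0.
  pose m x := inf (S x).
  have mle x (q : T) : A q -> m x <= sval q x.
    by move=> Aq; apply: ge_inf; [exists (- p (- x)); exact: lbS|exists q].
  have lem x r : (forall q : T, A q -> r <= sval q x) -> r <= m x.
    by move=> rq; apply: lb_le_inf => // _ [q Aq <-]; exact: rq.
  have mP : sublinear m /\ forall x, m x <= p x.
    split; last by move=> x; rewrite (le_trans (mle _ _ Aq0))//;
      exact: (svalP q0).2.
    split=> [x y|t x t0].
      rewrite -lerBlDr; apply: (lem) => q Aq; rewrite lerBlDr -lerBlDl.
      apply: (lem) => r Ar; rewrite lerBlDr.
      (* Subadditivity of an infimum uses the chain: the smaller of [q] and [r] serves at both
         points. *)
      have [/asboolP qr|/asboolP rq] := totA _ _ Aq Ar.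
        rewrite (le_trans (mle _ _ Ar))// (le_trans ((svalP r).1.1 _ _))//.
        by rewrite addrC lerD2l.
      rewrite (le_trans (mle _ _ Aq))// (le_trans ((svalP q).1.1 _ _))//.
      by rewrite addrC lerD2r.
    rewrite mulrC -ler_pdivrMr//; apply: (lem) => q Aq.
    rewrite ler_pdivrMr// (le_trans (mle _ _ Aq))// mulrC.
    exact: (svalP q).1.2.
  by exists (exist _ m mP) => q Aq; apply/asboolP => x /=; exact: mle.
exists q; split=> // r sr rq.
have rP : sublinear r /\ forall x, r x <= p x.
  by split=> // x; exact: le_trans (qp x).
have /(_ _)/asboolP := qmin (exist _ r rP); apply.
by apply/asboolP.
Qed.

(* The cone generated by (y, q y) yields a sublinear r <= q with r (- y) <= - q y;
   minimality forces q (- y) = - q y. *)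
Lemma minimal_sublinear_real_linear q : sublinear q ->
  (forall r, sublinear r -> (forall x, r x <= q x) -> forall x, q x <= r x) ->
  real_linear q.
Proof.
move=> sq qmin.
have qN y : q (- y) = - q y.
  apply/eqP; rewrite eq_le; apply/andP; split; last first.
    by rewrite lerNl; exact: sublinearN.
  pose C := [set c | exists2 t : R, 0 < t & c = (t%:C *: y, t * q y)].
  have [|r [sr rq rC]] := @sublinear_below_cone q C sq.
    split.
    - by exists ((1 : R)%:C *: y, 1 * q y), 1.
    - move=> _ _ [s s0 ->] [t t0 ->]; exists (s + t); first exact: addr_gt0.
      by rewrite /= rmorphD scalerDl mulrDl.
    - move=> s _ s0 [t t0 ->]; exists (s * t); first exact: mulr_gt0.
      by rewrite /= real_scalerA mulrA.
    - move=> _ [t t0 ->] /=.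
      have := sq.2 t^-1 (t%:C *: y); rewrite invr_gt0 => /(_ t0).
      by rewrite real_scalerA mulVf ?gt_eqF// real_scale1r ler_pdivlMl.
  rewrite (le_trans (qmin _ sr rq _))//.
  by apply: (rC (y, q y)); exists 1 => //; rewrite real_scale1r mul1r.
have qp (t : R) x : 0 < t -> q (t%:C *: x) = t * q x.
  move=> t0; apply/eqP; rewrite eq_le sq.2//=.
  have := sq.2 t^-1 (t%:C *: x); rewrite invr_gt0 => /(_ t0).
  by rewrite real_scalerA mulVf ?gt_eqF// real_scale1r ler_pdivlMl.
split=> [x y|t x].
  apply/eqP; rewrite eq_le sq.1/= -lerBrDr -qN.
  by rewrite -{1}[x](addrK y) sq.1.
have [t0|t0|->] := ltgtP t 0; last by rewrite scale0r mul0r; exact: sublinear0.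
  by rewrite -[t]opprK rmorphN scaleNr qN mulNr qp ?oppr_gt0.
exact: qp.
Qed.

(** A minimal sublinear [u] below the [q] of [sublinear_below_cone] is real-linear, so
    [u (- c.1) <= - c.2] turns into [c.2 <= u c.1]. *)
Lemma sublinear_sandwich p C : sublinear p -> cone_le p C ->
  exists u, [/\ real_linear u, forall x, u x <= p x &
    forall c, C c -> c.2 <= u c.1].
Proof.
move=> sp pC; have [q [sq qp qC]] := sublinear_below_cone sp pC.
have [u [su uq umin]] := minimal_sublinear sq.
have [uD uZ] := minimal_sublinear_real_linear su umin.
exists u; split=> // [x|c Cc]; first exact: le_trans (qp x).
rewrite -[leRHS]opprK lerNr (le_trans _ (qC _ Cc))//.
rewrite (le_trans _ (uq _))// -[- c.1]scaleN1r -(rmorphN1 (real_complex R)).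
by rewrite uZ mulN1r.
Qed.

End Sublinear.

(** * Complex functionals with prescribed real part *)

Section RealFunctionals.
Context {R : realType} {V : normedModType R[i]}.

Lemma rnorm_sublinear : sublinear (@rnorm R V).
Proof.
split; first exact: rnormD.
by move=> t x t0; rewrite rnormZr gtr0_norm.
Qed.

Lemma Re_le_rnorm (z : Cplx R) : complex.Re z <= rnorm z.
Proof.
case: z => a b; rewrite /rnorm normc_def /=.
rewrite (le_trans (ler_norm a))// -sqrtr_sqr ler_wsqrtr//.
by rewrite lerDl sqr_ge0.
Qed.

(** The complex functional is [u x - i u (i x)]. *)
Lemma real_functional_dual (u : V -> R) (M : R) : real_linear u -> 0 <= M ->
  (forall x, u x <= M * rnorm x) ->
  exists l : dual V, dual_norm l <= M /\ forall x, complex.Re (l x) = u x.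
Proof.
move=> [uD uZ] M0 uM.
pose l : V -> Cplx R := fun x => u x +i* (- u ('i%C *: x)).
have uE (a : R[i]) x :
    u (a *: x) = complex.Re a * u x + complex.Im a * u ('i%C *: x).
  rewrite -!uZ scalerA -uD -scalerDl; congr (u (_ *: x)).
  by rewrite [LHS]complexE mulrC.
have ll : linear l.
  move=> a x y; rewrite /l scalerDr (uD (a *: x)) (uD ('i%C *: (a *: x))).
  rewrite [in u ('i%C *: (a *: x))]scalerA (uE ('i%C * a)) (uE a).
  case: a => p q; apply/eqP; rewrite eq_complex /=.
  apply/andP; split; apply/eqP.
    by rewrite mulrN opprK.
  rewrite !mul0r !mul1r sub0r add0r !opprD mulrN mulNr opprK.
  by rewrite [_ - p * _]addrC.
have lM x : rnorm (l x) <= M * rnorm x.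
  have [l0|l0] := eqVneq (rnorm (l x)) 0.
    by rewrite l0 mulr_ge0 ?rnorm_ge0.
  have lp : 0 < rnorm (l x) by rewrite lt_neqAle eq_sym l0 rnorm_ge0.
  (* Rotating [x] by the conjugate of [l x] makes the value real: [u] there equals [|l x|^2]. *)
  have := uM (((l x)^*)%C *: x); rewrite rnormZ.
  have -> : complex.Re `|((l x)^*)%C| = rnorm (l x) by rewrite normcJ.
  suff -> : u (((l x)^*)%C *: x) = rnorm (l x) * rnorm (l x).
    by rewrite mulrCA ler_pM2l.
  rewrite /rnorm normc_def /= -expr2 sqr_sqrtr ?addr_ge0 ?sqr_ge0//.
  by rewrite (uE _ x) /= opprK sqrrN !expr2.
exists (Dual (dual_predP ll lM)); split=> //.
exact: dual_norm_le.
Qed.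

(** Sandwich a functional between the norm and the ray through [(v, rnorm v)]. *)
Lemma norming_functional (v : V) :
  exists l : dual V, dual_norm l <= 1 /\ complex.Re (l v) = rnorm v.
Proof.
pose C := [set c : V * R | exists2 t : R, 0 < t & c = (t%:C *: v, t * rnorm v)].
have [|u [ul ule uC]] := @sublinear_sandwich _ _ _ C rnorm_sublinear.
  split.
  - by exists ((1 : R)%:C *: v, 1 * rnorm v), 1.
  - move=> _ _ [s s0 ->] [t t0 ->]; exists (s + t); first exact: addr_gt0.
    by rewrite /= rmorphD scalerDl mulrDl.
  - move=> s _ s0 [t t0 ->]; exists (s * t); first exact: mulr_gt0.
    by rewrite /= real_scalerA mulrA.
  - by move=> _ [t t0 ->] /=; rewrite rnormZr gtr0_norm.
have [|l [l1 lu]] := real_functional_dual ul (@ler01 R).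
  by move=> x; rewrite mul1r.
exists l; split => //; rewrite lu; apply/eqP; rewrite eq_le ule/=.
by apply: (uC (v, rnorm v)); exists 1 => //; rewrite real_scale1r mul1r.
Qed.

Lemma rnorm_le_dual (v : V) (M : R) :
  (forall l : dual V, dual_norm l <= 1 -> rnorm (l v) <= M) -> rnorm v <= M.
Proof.
move=> lM; have [l [l1 <-]] := norming_functional v.
exact: le_trans (Re_le_rnorm _) (lM l l1).
Qed.

End RealFunctionals.

(** * Uniform boundedness *)

Section RealNormTopology.
Context {R : realType} {V : normedModType R[i]}.

Lemma complex_gt0P (e : R[i]) : 0 < e ->
  e = (complex.Re e)%:C /\ 0 < complex.Re e.
Proof.
move=> e0; have eE : e = (complex.Re e)%:C by rewrite RRe_real ?gtr0_real.
by split=> //; rewrite -ltcR -eE.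
Qed.

Lemma ball_rnormP (x y : V) (e : R) : ball x e%:C y <-> rnorm (x - y) < e.
Proof. by rewrite -ball_normE /= rnormE ltcR. Qed.

Lemma cvg_rnormP (T : Type) (F : set_system T) (FF : Filter F) (f : T -> V)
    (x : V) : f @ F --> x <->
  forall e : R, 0 < e -> \forall t \near F, rnorm (x - f t) < e.
Proof.
split=> [/cvgrPdist_lt fx e e0|fx].
  have := fx e%:C; rewrite ltcR => /(_ e0); apply: filterS => t.
  by rewrite rnormE ltcR.
apply/cvgrPdist_lt => e /complex_gt0P[-> e0]; apply: filterS (fx _ e0) => t.
by rewrite rnormE ltcR.
Qed.

Lemma nbhs_rnormP (x : V) (A : set V) :
  nbhs x A <-> exists2 e : R, 0 < e & forall y, rnorm (x - y) < e -> A y.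
Proof.
split=> [/nbhs_ballP[e /= /complex_gt0P[-> e0] eA]|[e e0 eA]].
  by exists (complex.Re e) => // y /ball_rnormP/eA.
apply/nbhs_ballP; exists e%:C => /=; first by rewrite ltcR.
by move=> y /ball_rnormP/eA.
Qed.

Lemma closure_rnormP (A : set V) (x : V) :
  closure A x <-> forall e : R, 0 < e -> exists2 y, A y & rnorm (x - y) < e.
Proof.
split=> [cA e e0|cA B /nbhs_rnormP[e e0 eB]].
  have [|y [Ay ey]] := cA [set y | rnorm (x - y) < e].
    by apply/nbhs_rnormP; exists e.
  by exists y.
by have [y Ay ye] := cA _ e0; exists y; split=> //; exact: eB.
Qed.

Lemma rnorm_distC (x y : V) : rnorm (x - y) = rnorm (y - x).
Proof. by rewrite -rnormN opprB. Qed.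

Lemma rnorm_triangle (z x y : V) :
  rnorm (x - y) <= rnorm (x - z) + rnorm (z - y).
Proof. by rewrite (le_trans _ (rnormD _ _))// addrA subrK. Qed.

End RealNormTopology.

Section BanachSteinhaus.
Context {R : realType} {E : completeNormedModType R[i]}.
Context {W : normedModType R[i]}.

(** The first hypothesis nests the closed balls and makes the radii decrease, so the centres are
    Cauchy; their limit lies in every ball. *)
Lemma complete_nested_balls (x : nat -> E) (r : nat -> R) :
  (forall n, rnorm (x n.+1 - x n) + r n.+1 <= r n) ->
  (forall n, 0 <= r n) -> (forall e : R, 0 < e -> exists n, r n < e) ->
  exists y, forall n, rnorm (y - x n) <= r n.
Proof.
move=> xr r0 re.
have nest n m : rnorm (x (n + m)%N - x n) + r (n + m)%N <= r n.
  elim: m => [|m IH]; first by rewrite addn0 subrr rnorm0 add0r.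
  rewrite addnS (le_trans _ IH)// (le_trans _ (lerD (lexx _) (xr _)))//.
  by rewrite addrA lerD2r [leRHS]addrC rnorm_triangle.
have far n m : (n <= m)%N -> rnorm (x m - x n) <= r n.
  move=> nm; have := nest n (m - n)%N; rewrite subnKC//; apply: le_trans.
  by rewrite lerDl.
have /cvg_ex[y /= /cvg_rnormP xy] : cvg (x @ \oo).
  apply/cauchy_cvgP/cauchy_exP => e /complex_gt0P[-> e0].
  have [n rn] := re _ e0; exists (x n).
  apply: filterS (nbhs_infty_ge n) => m nm; apply/ball_rnormP.
  by apply: le_lt_trans rn; rewrite rnorm_distC; exact: far.
exists y => n; apply/ler_addgt0Pr => e e0.
have [|m [nm my]] :=
    @filter_ex _ \oo _ (fun m => (n <= m)%N /\ rnorm (y - x m) < e).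
  by apply: filterI; [exact: nbhs_infty_ge|exact: xy].
by rewrite (le_trans (rnorm_triangle (x m) _ _))// addrC lerD ?far// ltW.
Qed.

(* Banach-Steinhaus along a filter basis S; the case of a constant S is the usual
   statement. If it fails, a point of infinitely many nested balls contradicts
   the pointwise bound. *)
Lemma banach_steinhaus_decreasing (T : Type) (S : nat -> set T)
    (q : T -> {linear E -> W}) :
  (forall m n, (m <= n)%N -> S n `<=` S m) ->
  (forall t, exists2 M, 0 <= M & forall u, rnorm (q t u) <= M * rnorm u) ->
  (forall u, exists n M, forall t, S n t -> rnorm (q t u) <= M) ->
  exists n, exists2 M, 0 <= M &
    forall t u, S n t -> rnorm (q t u) <= M * rnorm u.
Proof.
move=> Sdec qb qpb; apply: contrapT => nub.
have big n M : 0 <= M -> exists t u, S n t /\ M * rnorm u < rnorm (q t u).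
  move=> M0; apply: contrapT => nb; apply: nub; exists n, M => // t u Snt.
  by rewrite leNgt; apply/negP => tu; apply: nb; exists t, u.
(* Every ball contains a smaller one on which a single [q t], with [t] in [S n], has norm at least
   [n]. *)
have step n (x : E) (r : R) : 0 < r -> exists y, exists r' : R,
    [/\ 0 < r', r' <= r / 2, rnorm (y - x) + r' <= r &
    exists2 t, S n t & forall w, rnorm (w - y) <= r' -> n%:R <= rnorm (q t w)].
  move=> r0; pose a := r / 2; have a0 : 0 < a by rewrite divr_gt0.
  have M0 : 0 <= (n%:R + 1) / a by rewrite divr_ge0 ?ltW// addr_ge0.
  have [t [u [Snt tu]]] := big n _ M0.
  have u0 : 0 < rnorm u.
    rewrite lt_neqAle rnorm_ge0 andbT eq_sym; apply/eqP => /rnorm_eq0 u0.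
    by move: tu; rewrite u0 linear0 !rnorm0 mulr0 ltxx.
  pose v := (a / rnorm u)%:C *: u.
  have va : rnorm v = a by rewrite rnormZr gtr0_norm ?divr_gt0// divfK ?gt_eqF.
  have qv : n%:R + 1 < rnorm (q t v).
    rewrite linearZ rnormZr gtr0_norm ?divr_gt0// mulrAC ltr_pdivlMr//.
    by move: tu; rewrite mulrAC ltr_pdivrMr// [ltRHS]mulrC.
  (* One of [x + v] and [x - v] works: [q t v] is half the difference of the two values, and its
     norm exceeds [n + 1]. *)
  have [y yx qy] : exists2 y, rnorm (y - x) = a & n%:R + 1 <= rnorm (q t y).
    have [h|h] := leP (n%:R + 1) (rnorm (q t (x + v))).
      by exists (x + v) => //; rewrite addrC addKr.
    exists (x - v); first by rewrite addrC addKr rnormN.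
    rewrite leNgt; apply/negP => h'; move: qv; apply/negP; rewrite -leNgt.
    have : rnorm (q t v + q t v) <= rnorm (q t (x + v)) + rnorm (q t (x - v)).
      have -> : q t v + q t v = q t (x + v) - q t (x - v).
        by rewrite linearD linearB opprB [RHS]addrC addrA subrK.
      by rewrite (le_trans (rnormD _ _))// rnormN.
    have -> : q t v + q t v = (2 : R)%:C *: q t v.
      by rewrite -mulr2n -scaler_nat rmorph_nat.
    rewrite rnormZr gtr0_norm// => h2.
    have := le_lt_trans h2 (ltrD h h').
    by rewrite -[ltRHS]mulr2n -[ltRHS]mulr_natl ltr_pM2l// => /ltW.
  have [M Mge0 qM] := qb t.
  (* Radius [a = r / 2] keeps the new ball inside the old one; within [(M + 1)^-1] of [y] the value
     of [q t] moves by at most 1, which is the surplus in [n + 1]. *)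
  exists y, (Num.min a (M + 1)^-1).
  have M10 : 0 < M + 1 by rewrite ltr_wpDl.
  split.
  - by rewrite lt_min a0 invr_gt0.
  - by rewrite ge_min lexx.
  - by rewrite yx (splitr r) lerD2l ge_min lexx.
  - exists t => // w; rewrite le_min => /andP[_ wy].
    rewrite -(lerD2r 1) (le_trans qy)//.
    have -> : y = w - (w - y) by rewrite opprB addrCA subrr addr0.
    rewrite linearB (le_trans (rnormD _ _))// lerD2l rnormN.
    rewrite (le_trans (qM _))// (le_trans (ler_wpM2l Mge0 wy))//.
    by rewrite ler_pdivrMr// mul1r lerDl.
have [f fP] : {f : nat -> E * R -> E * R | forall n c, 0 < c.2 ->
    [/\ 0 < (f n c).2, (f n c).2 <= c.2 / 2,
        rnorm ((f n c).1 - c.1) + (f n c).2 <= c.2 &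
    exists2 t, S n t &
      forall w, rnorm (w - (f n c).1) <= (f n c).2 -> n%:R <= rnorm (q t w)]}.
  have H (nc : nat * (E * R)) : exists d : E * R, 0 < nc.2.2 ->
    [/\ 0 < d.2, d.2 <= nc.2.2 / 2, rnorm (d.1 - nc.2.1) + d.2 <= nc.2.2 &
    exists2 t, S nc.1 t &
      forall w, rnorm (w - d.1) <= d.2 -> nc.1%:R <= rnorm (q t w)].
    have [c0|c0] := ltP 0 nc.2.2; last by exists nc.2.
    by have [y [r' ?]] := step nc.1 nc.2.1 _ c0; exists (y, r').
  have [f fH] := choice H; exists (fun n c => f (n, c)) => n c c0.
  exact: (fH (n, c)).
pose c := fix c n := if n is n'.+1 then f n' (c n') else (0 : E, 1 : R).
have c0 n : 0 < (c n).2 by elim: n => //= n IH; have [] := fP n (c n) IH.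
have cle n : (c n).2 <= 2^-1 ^+ n.
  elim: n => [|n IH]; first by rewrite expr0.
  have [_ h _ _] := fP n (c n) (c0 n).
  by rewrite (le_trans h)// exprSr ler_wpM2r.
have [|||x xc] := @complete_nested_balls (fun n => (c n).1) (fun n => (c n).2).
- by move=> n; have [] := fP n (c n) (c0 n).
- by move=> n; exact: ltW.
- move=> e e0.
  have : 2^-1 ^+ n @[n --> \oo] --> (0 : R).
    by apply: cvg_expr; rewrite ger0_norm// invf_lt1// ltr1n.
  move=> /cvgrPdist_lt/(_ _ e0)/filter_ex[n]; rewrite sub0r normrN.
  by rewrite ger0_norm// => ne; exists n; exact: le_lt_trans ne.
have [n [M nM]] := qpb x.
(* As [S m] is contained in [S n], the bound [M] applies to the index chosen at stage [m], which
   produces ball [m.+1]. *)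
have [m nm Mm] : exists2 m : nat, (n <= m)%N & M < m%:R.
  exists (maxn n (Num.truncn M).+1); first exact: leq_maxl.
  rewrite (lt_le_trans (truncnS_gt _))//.
  by rewrite ler_nat leq_maxr.
have [_ _ _ [t St qt]] := fP m (c m) (c0 m).
have := nM _ (Sdec _ _ nm _ St); apply/negP; rewrite -ltNge (lt_le_trans Mm)//.
exact/qt/(xc m.+1).
Qed.

End BanachSteinhaus.

(** * Analyticity and boundedness of weighted compositions *)

Section WeightedComposition.
Context {R : realType} {X : normedModType R[i]}.

Lemma valL_disc (Y : normedModType R[i]) (f : disc R -> Y) (z : disc R) :
  'valL_ (0 : Y) f (val z) = f z.
Proof. exact: (congr1 (fun g => g z) (valLK (0 : Y) f)). Qed.

Lemma valL_out (Y : normedModType R[i]) (f : disc R -> Y) (w : Cplx R) :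
  ~ disc R w -> 'valL_ (0 : Y) f w = 0.
Proof.
move=> nw; rewrite -(valLK (0 : Y) f).
rewrite -[LHS]/(('valL_ 0 \o sigL (disc R)) ('valL_ 0 f) w).
by rewrite sigLK /patch memNset.
Qed.

Lemma valL_disc_cases (w : Cplx R) :
  (exists z : disc R, w = val z) \/ ~ disc R w.
Proof.
have [dw|] := pselect (disc R w); last by right.
by left; exists (SigSub (mem_set dw)).
Qed.

(** The Leibniz splitting [a w (f w - f z) + (a w - a z) f z], with continuity of [a] at [z] for the
    first term. *)
Lemma derivable_scale (a : Cplx R -> Cplx R) (f : Cplx R -> X) (z : Cplx R) :
  derivable a z 1 -> derivable f z 1 -> derivable (fun w => a w *: f w) z 1.
Proof.
move=> da df; apply/cvg_ex.
exists (a z *: 'D_1 f z + 'D_1 a z *: f z).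
rewrite (_ : (fun h => _) = fun h => a (h *: (1 : Cplx R) + z) *:
    (h^-1 *: (f (h *: (1 : Cplx R) + z) - f z)) +
    (h^-1 *: (a (h *: (1 : Cplx R) + z) - a z)) *: f z); last first.
  apply/funext => h /=; set w := h *: 1 + z.
  rewrite [a w *: (_ *: _)]scalerA mulrC -scalerA.
  rewrite -[(h^-1 *: (a w - a z)) *: f z]/((h^-1 * (a w - a z)) *: f z).
  rewrite -scalerA.
  by rewrite -scalerDr; congr (_ *: _); rewrite scalerBr scalerBl addrA subrK.
apply: cvgD; last by apply: cvgZr_tmp; exact: da.
apply: cvgZ; last exact: df.
suff : {for 0, continuous (fun h : Cplx R => a (h *: 1 + z))}.
  by move=> /continuous_withinNx; rewrite scale0r add0r.
exact/differentiable_continuous/derivable1_diffP/(derivable1P _ _ _).1.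
Qed.

Lemma analytic_weighted_composition (psi : disc R -> Cplx R)
    (phi : disc R -> disc R) (f : disc R -> X) :
  analytic psi -> analytic (fun z => val (phi z) : Cplx R) -> analytic f ->
  analytic (weighted_composition psi phi f).
Proof.
move=> apsi aphi af z.
pose p := 'valL_ (0 : Cplx R) (fun z => val (phi z) : Cplx R).
rewrite (_ : 'valL_ _ _ =
  fun w => 'valL_ (0 : Cplx R) psi w *: ('valL_ (0 : X) f \o p) w).
  apply: derivable_scale; first exact: apsi.
  apply/derivable1_diffP; apply: differentiable_comp.
    exact/derivable1_diffP/aphi.
  by rewrite /p valL_disc; exact/derivable1_diffP/af.
apply/funext => w; have [[y ->]|nw] := valL_disc_cases w.
  have py : p (val y) = val (phi y) by exact: valL_disc.
  rewrite -[RHS]/('valL_ (0 : Cplx R) psi (val y) *: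
    'valL_ (0 : X) f (p (val y))).
  by rewrite py !valL_disc.
(* Outside the disc [p] takes the value 0, where [f] need not vanish; the factor from [psi] does. *)
by rewrite !valL_out// scale0r.
Qed.

End WeightedComposition.

Lemma compact_locally_bounded (R : realType) (T : topologicalType) (A : set T)
    (f : T -> R) :
  compact A -> (forall x, A x -> exists M, \forall y \near x, f y <= M) ->
  exists M, forall x, A x -> f x <= M.
Proof.
move=> /compact_near_coveringP/(_ R (+oo) (fun M x => f x <= M)) cA fM.
have [|M [_ MA]] := cA _.
  move=> x /fM[M xM].
  exists ([set y | f y <= M], [set N | M <= N]) => /=.
    by split=> //; exact: nbhs_pinfty_ge (num_real M).
  by move=> [y N] /= [/le_trans]; apply.
(* Neighbourhoods of [+oo] are given by strict inequalities, hence [M + 1]. *)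
by exists (M + 1) => x Ax; apply: MA => //; rewrite ltrDl.
Qed.

Section UnitBall.
Context {R : realType} {V : normedModType R[i]}.

Lemma unit_ballE (x : V) : unit_ball x <-> rnorm x <= 1.
Proof. by rewrite /unit_ball /= le_rnorm1. Qed.

Lemma rnorm_locally_bounded (x : V) : exists M, \forall y \near x, rnorm y <= M.
Proof.
exists (rnorm x + 1); apply/nbhs_rnormP; exists 1 => // y xy.
rewrite -lerBlDl (le_trans _ (ltW xy))// rnorm_distC lerBlDl.
by rewrite -{1}[y](subrK x) addrC rnormD.
Qed.

End UnitBall.

Section LinearOperators.
Context {R : realType} {V W : normedModType R[i]}.

Lemma bounded_on_ball (T : {linear V -> W}) (M : R) :
  (forall x, rnorm x <= 1 -> rnorm (T x) <= M) ->
  forall x, rnorm (T x) <= M * rnorm x.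
Proof.
move=> TM x; have [x0|x0] := eqVneq (rnorm x) 0.
  by rewrite (rnorm_eq0 x0) linear0 !rnorm0 mulr0.
have xp : 0 < rnorm x by rewrite lt_neqAle eq_sym x0 rnorm_ge0.
have := TM ((rnorm x)^-1%:C *: x).
rewrite linearZ !rnormZr gtr0_norm ?invr_gt0// mulVf// => /(_ (lexx _)).
by rewrite mulrC ler_pdivrMr.
Qed.

Lemma bounded_operatorP (T : {linear V -> W}) :
  bounded_operator T <->
  exists2 M, 0 <= M & forall x, rnorm (T x) <= M * rnorm x.
Proof.
split=> [[M TM]|[M M0 TM]].
  exists `|M| => // x; rewrite (@le_trans _ _ (M * rnorm x))//.
    by have := TM x; rewrite !rnormE -(rmorphM (real_complex R)) lecR.
  by rewrite ler_wpM2r ?rnorm_ge0 ?ler_norm.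
exists M => x; by rewrite !rnormE -(rmorphM (real_complex R)) lecR.
Qed.

Lemma compact_operator_bounded (T : {linear V -> W}) :
  compact_operator T -> bounded_operator T.
Proof.
rewrite /compact_operator precompactE => cT.
have [|M TM] := compact_locally_bounded cT (f := @rnorm R W).
  by move=> x _; exact: rnorm_locally_bounded.
have TM1 x : rnorm x <= 1 -> rnorm (T x) <= M.
  by move=> x1; apply/TM/subset_closure; exists x => //; apply/unit_ballE.
apply/bounded_operatorP; exists M; last exact: bounded_on_ball.
by rewrite (le_trans _ (TM1 0 _)) ?rnorm_ge0// rnorm0.
Qed.

End LinearOperators.

(** * Boundedness of point evaluations *)

Section Evaluation.
Context {R : realType} (E : analyticBanachSpace R).

Lemma af_funZ (a : R[i]) (u : E) z : af_fun E (a *: u) z = a *: af_fun E u z.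
Proof. by rewrite linearZ. Qed.

Lemma af_funD (u v : E) z : af_fun E (u + v) z = af_fun E u z + af_fun E v z.
Proof. by rewrite linearD. Qed.

Lemma af_funB (u v : E) z : af_fun E (u - v) z = af_fun E u z - af_fun E v z.
Proof. by rewrite linearB. Qed.

(** Singletons are compact, so the value at [z] is locally bounded in the compact-open topology,
    hence bounded on the compact image of the unit ball; homogeneity does the rest. *)
Lemma ball_compact_eval (z : disc R) : ball_compact E ->
  exists2 c, 0 <= c & forall u : E, rnorm (af_fun E u z) <= c * rnorm u.
Proof.
move=> bE.
have [|c cE] := @compact_locally_bounded R
    {compact-open, disc R -> Cplx R} _ (fun g => rnorm (g z)) bE.
  move=> g _; have [M /nbhs_rnormP[e e0 eM]] := rnorm_locally_bounded (g z).
  exists M.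
  have : nbhs (g : {compact-open, disc R -> Cplx R})
      [set h | h @` [set z] `<=` ball (g z) e%:C].
    apply: open_nbhs_nbhs; split.
      apply: compact_open_open; first exact: compact_set1.
      exact: ball_open.
    by move=> _ [_ -> <-]; apply: ballxx; rewrite ltcR.
  apply: filterS => h /(_ (h z)) hz; apply: eM; apply/ball_rnormP; apply: hz.
  by exists z.
have c0 : 0 <= c.
  apply: le_trans (cE (af_fun E 0) _); first exact: rnorm_ge0.
  by exists 0 => //; apply/unit_ballE; rewrite rnorm0.
exists c => // u.
have [u0|u0] := eqVneq (rnorm u) 0.
  by rewrite (rnorm_eq0 u0) linear0 !rnorm0 mulr0.
have up : 0 < rnorm u by rewrite lt_neqAle eq_sym u0 rnorm_ge0.
have := cE (af_fun E ((rnorm u)^-1%:C *: u)).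
rewrite af_funZ rnormZr gtr0_norm ?invr_gt0// mulrC ler_pdivrMr//; apply.
exists ((rnorm u)^-1%:C *: u) => //.
by apply/unit_ballE; rewrite rnormZr gtr0_norm ?invr_gt0// mulVf.
Qed.

(** Difference quotients evaluate the extension by zero at points that may lie outside the disc. *)
Lemma valL_eval_bounded (w : Cplx R) : ball_compact E ->
  exists2 c, 0 <= c &
    forall u : E, rnorm ('valL_ (0 : Cplx R) (af_fun E u) w) <= c * rnorm u.
Proof.
move=> bE; have [[z ->]|nw] := valL_disc_cases w.
  have [c c0 cE] := ball_compact_eval z bE.
  by exists c => // u; rewrite valL_disc.
by exists 0 => // u; rewrite valL_out// rnorm0 mul0r.
Qed.

End Evaluation.

(** * Scalarizations of functions in the weak spaces *)

Section WeakSpaces.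
Context {R : realType}.

Lemma weak_norm_le (E : analyticBanachSpace R) (X : normedModType R[i])
    (f : disc R -> X) (M : R) :
  (forall l : dual X, dual_norm l <= 1 ->
    exists2 k : E, af_fun E k = l \o f & rnorm k <= M) ->
  (weak_norm E f <= M%:E)%E.
Proof.
move=> fM; apply: ge_ereal_sup => _ [l /unit_ballE l1 <-].
by have [k <- kM] := fM l l1; rewrite af_normE lee_fin.
Qed.

Lemma wspace_pull_ball (E : analyticBanachSpace R) (X : normedModType R[i])
    (f : wspace E X) (l : dual X) : dual_norm l <= 1 ->
  exists2 k : E, af_fun E k = l \o f & rnorm k <= rnorm f.
Proof.
move=> l1; have lf : (af_norm E (l \o f) <= weak_norm E f)%E.
  by apply: weak_norm_ub; rewrite le_rnorm1 rnorm_dual.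
have [k kl] := af_norm_fin (le_lt_trans lf (wspace_lty f)).
exists k => //; rewrite rnorm_wspace -lee_fin fineK ?weak_norm_fin_num//.
by rewrite -af_normE kl.
Qed.

(** The weak norm tests the unit ball of the dual; other functionals are rescaled into it. *)
Lemma wspace_pull (E : analyticBanachSpace R) (X : normedModType R[i])
    (f : wspace E X) (l : dual X) : exists k : E, af_fun E k = l \o f.
Proof.
have [l0|l0] := eqVneq (dual_norm l) 0.
  exists 0; rewrite (dual_norm_eq0 l0) linear0.
  by apply/funext => z.
have lp : 0 < dual_norm l by rewrite lt_neqAle eq_sym l0 dual_norm_ge0.
have [|k kl _] := wspace_pull_ball f (l := (dual_norm l)^-1%:C *: l).
  by rewrite -rnorm_dual rnormZr rnorm_dual gtr0_norm ?invr_gt0// mulVf.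
exists ((dual_norm l)%:C *: k); rewrite linearZ kl; apply/funext => z.
rewrite -[LHS]/((dual_norm l)%:C *: ((dual_norm l)^-1%:C *: l (f z))).
by rewrite real_scalerA mulfV// real_scale1r.
Qed.

(** The constant [M] survives because each scalarization of the image is [T k], where [k] represents
    [l \o f] and has norm at most that of [f]. *)
Lemma weighted_composition_wspace (E1 E2 : analyticBanachSpace R)
    (X : normedModType R[i]) (psi : disc R -> Cplx R) (phi : disc R -> disc R)
    (T : {linear E1 -> E2}) (M : R) :
  analytic psi -> analytic (fun z => val (phi z) : Cplx R) ->
  (forall k, af_fun E2 (T k) = weighted_composition psi phi (af_fun E1 k)) ->
  0 <= M -> (forall k, rnorm (T k) <= M * rnorm k) ->
  exists S : {linear wspace E1 X -> wspace E2 X},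
    (forall f,
      wspace_fun (S f) = weighted_composition psi phi (wspace_fun f)) /\
    forall f, rnorm (S f) <= M * rnorm f.
Proof.
move=> apsi aphi TW M0 TM.
have WM (f : wspace E1 X) :
    (weak_norm E2 (weighted_composition psi phi f) <= (M * rnorm f)%:E)%E.
  apply: weak_norm_le => l l1; have [k kl kf] := wspace_pull_ball f l1.
  exists (T k).
    rewrite TW kl; apply/funext => z.
    rewrite -[LHS]/(psi z *: l (f (phi z))).
    by rewrite -[RHS]/(l (psi z *: f (phi z))) linearZ.
  exact: le_trans (TM k) (ler_wpM2l M0 kf).
have Wp (f : wspace E1 X) :
    weighted_composition psi phi (wspace_fun f) \in @wspace_pred R E2 X.
  apply/asboolP; split; last exact: le_lt_trans (WM f) (ltry _).
  by apply: analytic_weighted_composition => //; exact: wspace_analytic.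
pose S f := WSpace (Wp f).
have Sl : linear S.
  move=> a f g; apply/val_inj/funext => z /=.
  rewrite -[LHS]/(psi z *: (a *: f (phi z) + g (phi z))).
  rewrite -[RHS]/(a *: (psi z *: f (phi z)) + psi z *: g (phi z)).
  by rewrite scalerDr !scalerA mulrC.
pose L : {linear wspace E1 X -> wspace E2 X} :=
  HB.pack S (GRing.isLinear.Build _ _ _ _ S Sl).
exists L; split => // f.
rewrite rnorm_wspace -lee_fin fineK ?weak_norm_fin_num//.
exact: WM.
Qed.

End WeakSpaces.

(** * Compact sets of analytic functions *)

(** A pointwise Cauchy family is eventually bounded at each point, hence equicontinuous by
    [banach_steinhaus_decreasing]; equicontinuity spreads the Cauchy estimate from a point to a
    neighbourhood, and compactness to [A]. *)
Lemma cauchy_uniform_on_compact (R : realType) (E : completeNormedModType R[i])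
    (W : normedModType R[i]) (T : Type) (S : nat -> set T)
    (q : T -> {linear E -> W}) (A : set E) :
  (forall m n, (m <= n)%N -> S n `<=` S m) ->
  (forall t, exists2 M, 0 <= M & forall u, rnorm (q t u) <= M * rnorm u) ->
  (forall u (e : R), 0 < e ->
    exists n, forall s t, S n s -> S n t -> rnorm (q s u - q t u) <= e) ->
  compact A -> forall e : R, 0 < e ->
  exists n, forall u s t, A u -> S n s -> S n t -> rnorm (q s u - q t u) <= e.
Proof.
move=> Sdec qb qc cA e e0.
have [|N [M M0 qM]] := banach_steinhaus_decreasing Sdec qb.
  move=> u; have [n nu] := qc u 1 ltr01; exists n.
  have [->|/set0P[s Ss]] := eqVneq (S n) set0; first by exists 0.
  exists (1 + rnorm (q s u)) => t St.
  by rewrite -{1}[q t u](subrK (q s u)) (le_trans (rnormD _ _))// lerD2r nu.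
have e3 : 0 < e / 3 by rewrite divr_gt0.
move/compact_near_coveringP/(_ nat \oo (fun n u => forall s t,
  S n s -> S n t -> rnorm (q s u - q t u) <= e)) : cA => cA.
have [|n _ nA] := cA _.
  move=> u Au; have [m mu] := qc u _ e3.
  exists ([set v | rnorm (u - v) < e / 3 / (M + 1)], [set n | maxn N m <= n]%N).
    split => /=; last exact: nbhs_infty_ge.
    apply/nbhs_rnormP; exists (e / 3 / (M + 1)) => //.
    by rewrite divr_gt0// ltr_wpDl.
  move=> [v n] /= [uv]; rewrite geq_max => /andP[Nn mn] s t Ss St.
  have close r : S n r -> rnorm (q r (u - v)) <= e / 3.
    move=> Sr; rewrite (le_trans (qM _ _ (Sdec _ _ Nn _ Sr)))//.
    rewrite (le_trans (ler_wpM2l M0 (ltW uv)))// mulrCA ler_piMr ?ltW//.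
    by rewrite ltr_pdivrMr ?mul1r ?ltrDl// ltr_wpDl.
  (* Two terms are small by equicontinuity, the last by the Cauchy property at [u]. *)
  have -> : q s v - q t v = q t (u - v) - q s (u - v) + (q s u - q t u).
    rewrite (linearB (q t)) (linearB (q s)) opprB [RHS]addrC !addrA subrK.
    by rewrite [_ - _ + q s v]addrC addrA addrAC addrK.
  have -> : e = e / 3 + e / 3 + e / 3 by lra.
  rewrite (le_trans (rnormD _ _))// lerD//; last first.
    by apply: mu; [exact: Sdec Ss|exact: Sdec St].
  by rewrite (le_trans (rnormD _ _))// rnormN lerD// close.
by exists n => u s t Au; apply: (nA n) => //=.
Qed.

Lemma rnorm_real (R : realType) (t : R) : rnorm (t%:C : Cplx R) = `|t|.
Proof. by rewrite /rnorm normc_def /= expr0n addr0 sqrtr_sqr. Qed.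

(** * Difference quotients and the Cauchy criterion *)

Section DifferenceQuotients.
Context {R : realType} {X : normedModType R[i]}.

Definition difference_quotient (f : Cplx R -> X) (z h : Cplx R) : X :=
  h^-1 *: (f (h *: (1 : Cplx R) + z) - f z).

(** A countable basis of punctured neighbourhoods of 0, as the decreasing sequence that
    [banach_steinhaus_decreasing] takes. *)
Definition punctured_disc (n : nat) : set (Cplx R) :=
  [set h | h != 0 /\ rnorm h < n.+1%:R^-1].

Lemma punctured_disc_le m n :
  (m <= n)%N -> punctured_disc n `<=` punctured_disc m.
Proof.
move=> mn h [h0 hn]; split => //; apply: lt_le_trans hn _.
by rewrite lef_pV2 ?posrE ?ltr0n// ler_nat.
Qed.

Lemma dnbhs_punctured_disc (A : set (Cplx R)) :
  (0 : Cplx R)^' A <-> exists n, punctured_disc n `<=` A.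
Proof.
split=> [/nbhs_rnormP[e e0 eA]|[n nA]].
  have [n ne] : exists n, n.+1%:R^-1 < e.
    exists (Num.truncn e^-1); rewrite -ltf_pV2 ?posrE ?invr_gt0// invrK.
    exact: truncnS_gt.
  exists n => h [h0 hn]; apply: eA => //.
  by rewrite sub0r rnormN (lt_trans hn).
apply/nbhs_rnormP; exists n.+1%:R^-1; first by rewrite invr_gt0.
by move=> h; rewrite sub0r rnormN => hn h0; apply: nA.
Qed.

Lemma derivable_cauchy (f : Cplx R -> X) (z : Cplx R) (e : R) :
  derivable f z 1 -> 0 < e ->
  exists n, forall h k, punctured_disc n h -> punctured_disc n k ->
    rnorm (difference_quotient f z h - difference_quotient f z k) <= e.
Proof.
move=> /cvg_ex[d /cvg_rnormP df] e0.
have /df/dnbhs_punctured_disc[n nd] : 0 < e / 2 by rewrite divr_gt0.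
exists n => h k /nd hd /nd kd.
rewrite (le_trans (rnorm_triangle d _ _))// [leRHS]splitr lerD//.
  by rewrite rnorm_distC ltW.
exact: ltW.
Qed.

End DifferenceQuotients.

Lemma cauchy_derivable (R : realType) (X : completeNormedModType R[i])
    (f : Cplx R -> X) (z : Cplx R) :
  (forall e : R, 0 < e ->
    exists n, forall h k, punctured_disc n h -> punctured_disc n k ->
    rnorm (difference_quotient f z h - difference_quotient f z k) <= e) ->
  derivable f z 1.
Proof.
move=> fc; apply/cauchy_cvgP/cauchy_exP => e /complex_gt0P[-> e0].
have [|n nf] := fc (complex.Re e / 2); first by rewrite divr_gt0.
(* The real number [1 / (n + 2)] is a sample point of [punctured_disc n]; the quotient there is the
   centre of the Cauchy ball. *)
have n2 : rnorm ((n.+2%:R^-1 : R)%:C : Cplx R) = n.+2%:R^-1.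
  by rewrite rnorm_real ger0_norm ?invr_ge0.
have pn : punctured_disc n ((n.+2%:R^-1 : R)%:C : Cplx R).
  split; last by rewrite n2 ltf_pV2 ?posrE ?ltr0n// ltr_nat.
  apply/eqP => h0; move: n2; rewrite h0 rnorm0 => /esym/eqP.
  by rewrite invr_eq0 pnatr_eq0.
exists (difference_quotient f z (n.+2%:R^-1)%:C); apply/dnbhs_punctured_disc.
exists n => h hn; apply/ball_rnormP; rewrite (le_lt_trans (nf _ _ pn hn))//.
by rewrite ltr_pdivrMr// ltr_pMr// ltr1n.
Qed.

Section CompactFamilies.
Context {R : realType} (E : analyticBanachSpace R).

Lemma valL_dual (X : normedModType R[i]) (l : dual X) (g : disc R -> X) w :
  'valL_ (0 : Cplx R) (l \o g) w = l ('valL_ (0 : X) g w).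
Proof.
have [[z ->]|nw] := valL_disc_cases w; first by rewrite !valL_disc.
by rewrite !valL_out// linear0.
Qed.

(** Difference quotients of elements of [E] at [z] are bounded functionals [q h] on [E], Cauchy at
    each element, so uniformly Cauchy on [A]. Those of [g] are tested against [l] in the dual ball,
    where they become [q h u] with [u] in [A]. *)
Lemma analytic_of_compact_scalarization (X : completeNormedModType R[i])
    (A : set E) (g : disc R -> X) : ball_compact E -> compact A ->
  (forall l : dual X, dual_norm l <= 1 ->
    exists2 u, A u & af_fun E u = l \o g) ->
  analytic g.
Proof.
move=> bE cA Ag z.
pose Q h (u : E) : Cplx R :=
  difference_quotient ('valL_ (0 : Cplx R) (af_fun E u)) (val z) h.
have extD a (u v : E) w : 'valL_ (0 : Cplx R) (af_fun E (a *: u + v)) w =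
    a *: 'valL_ (0 : Cplx R) (af_fun E u) w +
    'valL_ (0 : Cplx R) (af_fun E v) w.
  have [[y ->]|nw] := valL_disc_cases w; last first.
    by rewrite !valL_out// scaler0 addr0.
  by rewrite !valL_disc af_funD af_funZ.
have Ql h : linear (Q h).
  move=> a u v; rewrite /Q /difference_quotient !extD opprD addrACA.
  by rewrite -scalerBr scalerDr !scalerA mulrC.
pose q h : {linear E -> Cplx R} :=
  HB.pack (Q h) (GRing.isLinear.Build _ _ _ _ (Q h) (Ql h)).
apply: cauchy_derivable => e e0.
have [||n nA] := @cauchy_uniform_on_compact _ _ _ _ punctured_disc q A
  punctured_disc_le _ _ cA e e0.
- move=> h; have [c c0 cE] := valL_eval_bounded (h *: (1 : Cplx R) + val z) bE.
  have [d d0 dE] := valL_eval_bounded (val z) bE.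
  exists (complex.Re `|h^-1| * (c + d)).
    by rewrite mulr_ge0 ?ReN_ge0 ?addr_ge0.
  move=> u; rewrite -[q h u]/(Q h u) /Q /difference_quotient rnormZ.
  rewrite -mulrA ler_wpM2l ?ReN_ge0//.
  by rewrite (le_trans (rnormD _ _))// rnormN mulrDl lerD.
- by move=> u r r0; apply: derivable_cauchy r0; exact: af_analytic.
exists n => h k hn kn; apply: rnorm_le_dual => l l1.
have [u Au ul] := Ag l l1.
have lQ j : l (difference_quotient ('valL_ (0 : X) g) (val z) j) = q j u.
  rewrite -[q j u]/(Q j u) /Q ul /difference_quotient.
  by rewrite linearZ linearB !valL_dual.
by have := nA u h k Au hn kn; rewrite -!lQ linearB.
Qed.

(* On the compact set A the norm topology is that of pointwise convergence. *)
Lemma rnorm_le_points (A : set E) (e : R) :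
  ball_compact E -> compact A -> 0 < e ->
  exists (s : seq (disc R)) (c : R), 0 <= c /\ forall u, A u ->
    rnorm u <= e \/ exists2 z, z \in s & rnorm u <= c * rnorm (af_fun E u z).
Proof.
move=> bE cA e0.
(* Pairs of a list of points and a constant are directed, and enlarging a pair preserves the
   estimate; compactness merges the local choices into one pair. *)
pose B (i : seq (disc R) * R) :=
  [set j : seq (disc R) * R | {subset i.1 <= j.1} /\ i.2 <= j.2].
have FF : Filter (filter_from setT B).
  apply: filter_from_filter; first by exists ([::], 0).
  move=> [s c] [t d] _ _; exists (s ++ t, Num.max c d) => // -[r a] /= [rs].
  rewrite ge_max => /andP[ca da]; split; split => //= z zs; apply: rs.
    by rewrite mem_cat zs.
  by rewrite mem_cat zs orbT.
move/compact_near_coveringP/(_ _ (filter_from setT B) (fun j u =>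
  rnorm u <= e \/ exists2 z, z \in j.1 & rnorm u <= j.2 * rnorm (af_fun E u z)))
  : cA => cA.
have [|[s c] _ sc] := cA _; last first.
  exists s, (Num.max c 0); split; first by rewrite le_max lexx orbT.
  by move=> u; apply: (sc (s, Num.max c 0)); split => //=; rewrite le_max lexx.
move=> u Au; have [eu|ue] := leP e (rnorm u); last first.
  exists ([set v | rnorm (u - v) < e - rnorm u], setT).
    split => /=; last by exists ([::], 0).
    by apply/nbhs_rnormP; exists (e - rnorm u); rewrite ?subr_gt0.
  move=> [v j] /= [uv _]; left.
  rewrite -[v](subrK u) (le_trans (rnormD _ _))// -lerBrDr rnorm_distC.
  exact: ltW.
(* Here [u] has norm at least [e], so it is nonzero, and [af_fun] is injective. *)
have [z uz] : exists z, af_fun E u z != 0.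
  apply: contrapT => nz; have u0 : u = 0.
    apply: (@af_inj _ E); rewrite linear0; apply/funext => z.
    by apply: contrapT => /eqP uz; apply: nz; exists z.
  by move: eu; rewrite u0 rnorm0 leNgt e0.
have a0 : 0 < rnorm (af_fun E u z).
  rewrite lt_neqAle rnorm_ge0 andbT eq_sym.
  by apply: contra_neq uz; exact: rnorm_eq0.
set a := rnorm (af_fun E u z) in a0.
have [c c0 cE] := ball_compact_eval z bE.
(* Near [u] the norm is at most [rnorm u + 1] and the value at [z] at least [a / 2] in modulus; [C]
   is the quotient. *)
pose C := (rnorm u + 1) / (a / 2).
have ca : 0 < a / 2 / (c + 1) by rewrite !divr_gt0// ltr_wpDl.
exists ([set v | rnorm (u - v) < Num.min 1 (a / 2 / (c + 1))], B ([:: z], C)).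
  split => /=; last by exists ([:: z], C).
  by apply/nbhs_rnormP; exists (Num.min 1 (a / 2 / (c + 1))) => //;
    rewrite lt_min ltr01.
move=> [v [s d]] /= [+ [zs Cd]]; rewrite lt_min => /andP[uv1 uv].
right; exists z; first by apply: zs; rewrite mem_head.
have C0 : 0 <= C by rewrite !divr_ge0 ?addr_ge0 ?rnorm_ge0// ltW.
have vz : a / 2 <= rnorm (af_fun E v z).
  have : a <= rnorm (af_fun E (u - v) z) + rnorm (af_fun E v z).
    by rewrite af_funB (le_trans _ (rnormD _ _))// subrK.
  have : rnorm (af_fun E (u - v) z) <= a / 2.
    rewrite (le_trans (cE _))// (le_trans (ler_wpM2l c0 (ltW uv)))//.
    rewrite mulrCA ler_piMr ?divr_ge0 ?ltW// ltr_pdivrMr ?mul1r ?ltrDl//.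
    by rewrite ltr_wpDl.
  lra.
have vu : rnorm v <= rnorm u + 1.
  rewrite -[v](subrK u) (le_trans (rnormD _ _))// addrC lerD2l rnorm_distC.
  exact: ltW.
rewrite (le_trans vu)// (@le_trans _ _ (C * (a / 2)))//.
  by rewrite divfK// gt_eqF// divr_gt0.
by rewrite ler_pM// ltW// divr_gt0.
Qed.

End CompactFamilies.

Lemma Re_scale (R : realType) (t : R) (z : Cplx R) :
  complex.Re (t%:C *: z) = t * complex.Re z.
Proof. by case: z => a b /=; rewrite mul0r subr0. Qed.

(** * Weak compactness *)

Definition symmetric_convex (R : realType) (V : lmodType R[i]) (A : set V) :=
  (forall x, A x -> A (- x)) /\
  (forall (s t : R) x y, 0 < s -> 0 < t -> s + t = 1 -> A x -> A y ->
    A (s%:C *: x + t%:C *: y)).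

Section Scalarization.
Context {R : realType} (E : analyticBanachSpace R) (X : normedModType R[i]).

(** For [A] the closure of the image of the scalar ball, this is the weakly compact set that
    contains the image of the vector-valued ball. *)
Definition scalarized_in (A : set E) : set (wspace E X) :=
  [set h : wspace E X | forall l : dual X, dual_norm l <= 1 ->
    exists2 u, A u & af_fun E u = l \o h].

Lemma scalarized_in_convex (A : set E) :
  symmetric_convex A -> symmetric_convex (scalarized_in A).
Proof.
move=> [AN AC]; split=> [h Kh l l1|s t h k s0 t0 st Kh Kk l l1].
  have [u Au ul] := Kh l l1; exists (- u); first exact: AN.
  by rewrite linearN ul; apply/funext => z; exact/esym/linearN.
have [u Au ul] := Kh l l1; have [v Av vl] := Kk l l1.
exists (s%:C *: u + t%:C *: v); first exact: AC.
apply/funext => z; rewrite af_funD !af_funZ ul vl.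
rewrite -[RHS]/(l (s%:C *: h z + t%:C *: k z)) linearD.
by congr (_ + _); exact/esym/linearZ.
Qed.

Definition point_mass (z : disc R) (x : X) : disc R -> X :=
  fun w => if w == z then x else 0.

(** The bound makes [u] vanish on functions that are 0 on [s], so [y] may be replaced by the sum of
    its point masses; without repetitions in [s] the two agree there. *)
Lemma real_linear_points (u : (disc R -> X) -> R) (s : seq (disc R)) (c : R) :
  real_linear u -> uniq s ->
  (forall y, u y <= c * \sum_(z <- s) rnorm (y z)) ->
  forall y, u y = \sum_(z <- s) u (point_mass z (y z)).
Proof.
move=> [uD uZ] us uc y.
have u0 : u 0 = 0 by have := uZ 0 0; rewrite scaler0 mul0r.
have -> : \sum_(z <- s) u (point_mass z (y z)) =
    u (\sum_(z <- s) point_mass z (y z)).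
  by rewrite (big_morph u uD u0).
set w := \sum_(z <- s) _.
have yw z : z \in s -> y z = w z.
  move=> zs; rewrite /w fct_sumE (bigD1_seq z)//= {1}/point_mass eqxx.
  rewrite big1 ?addr0// => v vz; rewrite /point_mass eq_sym.
  by rewrite (negbTE vz).
have uN x : u (- x) = - u x.
  by rewrite -scaleN1r -(rmorphN1 (real_complex R)) uZ mulN1r.
have van x : (forall z, z \in s -> x z = 0) -> u x <= 0.
  move=> xs; rewrite (le_trans (uc x))// big_seq big1 ?mulr0// => z zs.
  by rewrite xs// rnorm0.
have := van (y - w); have := van (w - y); rewrite !uD !uN !subr_le0 => h1 h2.
apply/eqP; rewrite eq_le h2 ?h1// => z zs.
  by rewrite -[LHS]/(w z - y z) yw// subrr.
by rewrite -[LHS]/(y z - w z) yw// subrr.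
Qed.

(** The sandwich is applied on the space of all functions from the disc to [X]: a weighted sum of
    norms at finitely many points lies above [Re Phi - e] on [scalarized_in A]. The functional in
    between depends on those points only and splits into coordinates. *)
Lemma dual_scalarized_approx (A : set E) (Phi : dual (wspace E X)) (e : R) :
  ball_compact E -> compact A -> symmetric_convex A -> 0 < e ->
  exists (s : seq (disc R)) (m : disc R -> dual X),
    forall k : wspace E X, scalarized_in A k ->
      complex.Re (Phi k) <= \sum_(z <- s) complex.Re (m z (k z)) + e.
Proof.
move=> bE cA sA e0.
have [k0|/set0P[k0 Kk0]] := eqVneq (scalarized_in A) set0.
  by exists [::], (fun _ => 0) => k; rewrite k0.
pose N := dual_norm Phi; have N0 : 0 <= N := dual_norm_ge0 Phi.
have N1 : 0 < N + 1 by rewrite ltr_wpDl.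
(* With tolerance [e / (N + 1)] the error after applying [Phi] is at most [e], even for [N = 0]. *)
have [s' [c [c0 sc]]] := rnorm_le_points bE cA (divr_gt0 e0 N1).
pose s := undup s'; have us : uniq s by exact: undup_uniq.
pose p (y : disc R -> X) := N * c * \sum_(z <- s) rnorm (y z).
have Nc0 : 0 <= N * c by rewrite mulr_ge0.
have sp : sublinear p.
  split=> [x y|t x t0].
    rewrite -mulrDr ler_wpM2l// -big_split ler_sum// => z _.
    exact: rnormD.
  rewrite /p mulrCA ler_wpM2l// mulr_sumr ler_sum// => z _.
  by rewrite -[(_ *: x) z]/(t%:C *: x z) rnormZr gtr0_norm.
have normK (k : wspace E X) : scalarized_in A k ->
    rnorm k <= c * \sum_(z <- s) rnorm (k z) + e / (N + 1).
  move=> Kk; rewrite rnorm_wspace -lee_fin fineK ?weak_norm_fin_num//.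
  apply: weak_norm_le => l l1; have [u Au ul] := Kk l l1; exists u => //.
  have S0 : 0 <= c * \sum_(z <- s) rnorm (k z).
    by rewrite mulr_ge0// sumr_ge0// => z _; exact: rnorm_ge0.
  have [ue|[z zs uz]] := sc u Au; first by rewrite (le_trans ue)// lerDr.
  rewrite (le_trans uz)//; apply: ler_wpDr; first by rewrite divr_ge0 ?ltW.
  apply: ler_wpM2l => //.
  rewrite ul (le_trans (dual_normP _ _))//.
  rewrite (@le_trans _ _ (rnorm (k z)))//.
    by rewrite ler_piMl ?rnorm_ge0.
  rewrite (bigD1_seq z) ?mem_undup//= lerDl sumr_ge0// => w _.
  exact: rnorm_ge0.
(* The cone generated by the graph of [Re Phi - e] over [scalarized_in A]. *)
pose C := [set d : (disc R -> X) * R | exists t k,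
  [/\ 0 < t, scalarized_in A k &
  d = (t%:C *: (k : disc R -> X), t * (complex.Re (Phi k) - e))]].
have [|u [ul up uC]] := @sublinear_sandwich _ _ p C sp.
  split.
  - exists ((1 : R)%:C *: (k0 : disc R -> X), 1 * (complex.Re (Phi k0) - e)).
    by exists 1, k0.
  - move=> _ _ [s1 [k1 [s10 K1 ->]]] [s2 [k2 [s20 K2 ->]]] /=.
    have s12 : 0 < s1 + s2 by rewrite addr_gt0.
    (* A sum of two cone elements is [s1 + s2] times a convex combination. *)
    exists (s1 + s2), ((s1 / (s1 + s2))%:C *: k1 + (s2 / (s1 + s2))%:C *: k2).
    split => //.
      apply: (scalarized_in_convex sA).2 => //; rewrite ?divr_gt0//.
      by rewrite -mulrDl mulfV ?gt_eqF.
    have cK r : (s1 + s2) * (r / (s1 + s2)) = r by rewrite mulrC divfK ?gt_eqF.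
    congr (_, _).
      apply/funext => z.
      rewrite -[RHS]/((s1 + s2)%:C *: ((s1 / (s1 + s2))%:C *: k1 z +
        (s2 / (s1 + s2))%:C *: k2 z)).
      by rewrite scalerDr !real_scalerA !cK.
    rewrite linearD !linearZ raddfD/= !Re_scale [RHS]mulrBr [in RHS]mulrDr.
    rewrite [X in _ = X + _ - _]mulrA [X in _ = _ + X - _]mulrA.
    by rewrite !cK; lra.
  - move=> r _ r0 [t [k [t0 Kk ->]]] /=; exists (r * t), k; split => //.
      exact: mulr_gt0.
    by rewrite real_scalerA mulrA.
  - move=> _ [t [k [t0 Kk ->]]] /=.
    apply: (@le_trans _ _ (t * p k)).
      apply: ler_wpM2l; first exact: ltW.
      rewrite lerBlDr (le_trans (Re_le_rnorm _))//.
      rewrite (le_trans (dual_normP _ _))//.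
      rewrite (le_trans (ler_wpM2l N0 (normK _ Kk)))//.
      rewrite mulrDr /p mulrA lerD2l mulrCA.
      by apply: ler_piMr; [exact: ltW|rewrite ler_pdivrMr// mul1r lerDl].
    rewrite /p mulrCA ler_wpM2l// mulr_sumr ler_sum// => z _.
    by rewrite -[(_ *: _) z]/(t%:C *: k z) rnormZr gtr0_norm.
have mz (z : disc R) : exists m : dual X,
    forall x, complex.Re (m x) = u (point_mass z x).
  have [| | |m [_ mu]] :=
    @real_functional_dual _ _ (fun x => u (point_mass z x)) (N * c).
  - split=> [x y|t x].
      rewrite -ul.1; congr u; apply/funext => w.
      rewrite -[RHS]/(point_mass z x w + point_mass z y w) /point_mass.
      by case: ifP => _; rewrite ?addr0.
    rewrite -ul.2; congr u; apply/funext => w.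
    rewrite -[RHS]/(t%:C *: point_mass z x w) /point_mass.
    by case: ifP => _; rewrite ?scaler0.
  - exact: Nc0.
  - move=> x; rewrite (le_trans (up _))// ler_wpM2l//.
    have [zs|zs] := boolP (z \in s).
      rewrite (bigD1_seq z)//= /point_mass eqxx big1 ?addr0// => w /negbTE->.
      by rewrite rnorm0.
    rewrite big_seq big1 ?rnorm_ge0// => w ws; rewrite /point_mass.
    by case: ifP ws zs => [/eqP-> ->//|_]; rewrite rnorm0.
  by exists m.
have [m mu] := choice mz.
exists s, m => k Kk; rewrite -lerBlDr.
under eq_bigr do rewrite mu.
rewrite -(real_linear_points ul us up).
apply: (uC (k : disc R -> X, complex.Re (Phi k) - e)).
by exists 1, k; split => //; rewrite real_scale1r mul1r.
Qed.

End Scalarization.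

Lemma fmap_ultra (T U : Type) (f : T -> U) (F : set_system T) :
  UltraFilter F -> UltraFilter (f @ F).
Proof.
move=> FU; split; first exact: fmap_proper_filter.
move=> G GF FG; apply/seteqP; split; last exact: FG.
move=> B GB; have [//|nB] := in_ultra_setVsetC (f @^-1` B) FU.
have /FG GnB : (f @ F) (~` B) by [].
by have /filter_ex[x []] : G (B `&` ~` B) by exact: filterI.
Qed.

Lemma near_sum_le (R : realFieldType) (T I : Type) (F : set_system T)
    (s : seq I) (f : I -> T -> R) : Filter F ->
  (forall i e, 0 < e -> \forall t \near F, f i t <= e) ->
  forall e, 0 < e -> \forall t \near F, \sum_(i <- s) f i t <= e.
Proof.
move=> FF fe; elim: s => [|i s IH] e e0.
  by apply: nearW => t; rewrite big_nil ltW.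
have e2 : 0 < e / 2 by rewrite divr_gt0.
apply: filterS2 (fe i _ e2) (IH _ e2) => t ht hs.
by rewrite big_cons (splitr e) lerD.
Qed.

(** Real and imaginary parts lie in [[-e, e]]. This turns one-sided estimates for the real parts of
    four rotations of a functional into a bound on its modulus. *)
Lemma cplx_le_rotations (R : realType) (z : Cplx R) (e : R) :
  complex.Re z <= e -> complex.Re (- z) <= e ->
  complex.Re ('i%C *: z) <= e -> complex.Re (- ('i%C *: z)) <= e ->
  rnorm z <= e + e.
Proof.
case: z => a b; rewrite /rnorm normc_def /= !mul0r !mul1r !sub0r opprK.
move=> ae nae be nbe.
have e0 : 0 <= e by lra.
rewrite -(ger0_norm (addr_ge0 e0 e0)) -sqrtr_sqr ler_wsqrtr//.
nra.
Qed.

(** * Convergence and separation in the weak topology *)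

Section WeakTopology.
Context {R : realType} {V : normedModType R[i]}.

Lemma dual_separates (v w : V) : (forall l : dual V, l v = l w) -> v = w.
Proof.
move=> lvw; apply/eqP; rewrite -subr_eq0; apply/eqP/rnorm_eq0/eqP.
rewrite eq_le rnorm_ge0 andbT; apply: rnorm_le_dual => l _.
by rewrite linearB /= lvw subrr rnorm0.
Qed.

Lemma weak_cvg (F : set_system V) (v : V) : Filter F ->
  (forall (l : dual V) (e : R), 0 < e ->
    \forall x \near F, rnorm (l v - l x) <= e) ->
  F --> (v : weak V).
Proof.
move=> FF Fl.
pose ev (x : V) : {ptws dual V -> Cplx R} := fun l => l x.
have evF : ev @ F --> ev v.
  apply/pointwise_cvgP => l; apply/cvg_rnormP => e e0.
  have e2 : 0 < e / 2 by rewrite divr_gt0.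
  apply: filterS (Fl l _ e2) => x /le_lt_trans; apply.
  by rewrite ltr_pdivrMr// ltr_pMr// ltr1n.
move=> B /= [_ [[U oU <-] Uv UB]]; apply: filterS UB _.
by apply: evF; apply: open_nbhs_nbhs.
Qed.

Lemma weak_dual_continuous (l : dual V) : continuous (l : weak V -> Cplx R).
Proof.
move=> v.
pose ev (x : V) : {ptws dual V -> Cplx R} := fun l => l x.
apply: (@continuous_comp (weak V) {ptws dual V -> Cplx R} (Cplx R) ev
  (fun f => f l)).
  exact: initial_continuous.
exact: (@proj_continuous _ (fun=> Cplx R) l).
Qed.

Lemma weak_hausdorff : hausdorff_space (weak V).
Proof.
move=> v w vw; have lvw (l : dual V) : l v = l w.
  apply: (@norm_hausdorff _ (Cplx R)) => A B Av Bw.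
  have [x [Ax Bx]] :=
    vw _ _ (weak_dual_continuous Av) (weak_dual_continuous Bw).
  by exists (l x).
exact: dual_separates.
Qed.

End WeakTopology.

Section WeakCompactness.
Context {R : realType} (E : analyticBanachSpace R).

(** By symmetry and convexity [(g - h) / 2] lies in [scalarized_in A], so [dual_scalarized_approx]
    bounds the functional there by finitely many scalar values, which tend to 0 along [F]. *)
Lemma scalarized_in_weak_cvg (X : normedModType R[i]) (A : set E)
    (F : set_system (wspace E X)) (g : wspace E X) : Filter F ->
  ball_compact E -> compact A -> symmetric_convex A ->
  F (scalarized_in A) -> scalarized_in A g ->
  (forall (z : disc R) (l : dual X) (e : R), 0 < e ->
    F [set h : wspace E X | rnorm (l (g z) - l (h z)) <= e]) ->
  F --> (g : weak (wspace E X)).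
Proof.
move=> FF bE cA sA FA Ag Fg; apply: weak_cvg => Phi e e0.
have near_re (Psi : dual (wspace E X)) (d : R) : 0 < d ->
    F [set h : wspace E X | complex.Re (Psi g - Psi h) <= d].
  move=> d0; have d4 : 0 < d / 4 by rewrite divr_gt0.
  (* The error [d / 4] and the half of [d / 2] from the finite sum add up to [d / 2], the bound for
     half the difference. *)
  have [s [m sm]] := dual_scalarized_approx Psi bE cA sA d4.
  have [KN KC] := @scalarized_in_convex _ _ X _ sA.
  have mg : F [set h : wspace E X |
      \sum_(z <- s) rnorm (m z (g z) - m z (h z)) <= d / 2].
    by apply: near_sum_le; rewrite ?divr_gt0// => z r r0; exact: Fg.
  apply: filterS2 FA mg => h Ah mgh.
  have half0 : 0 < 2^-1 :> R by rewrite invr_gt0.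
  have ReB (V : normedModType R[i]) (l : dual V) v w :
      complex.Re (l (2^-1%:C *: v + 2^-1%:C *: - w)) =
      2^-1 * complex.Re (l v - l w).
    by rewrite linearD !linearZ linearN -scalerDr Re_scale.
  have Kgh : scalarized_in A (2^-1%:C *: g + 2^-1%:C *: - h).
    by apply: KC => //; [rewrite -div1r -splitr|exact: KN].
  have := sm _ Kgh; rewrite ReB.
  have : \sum_(z <- s) complex.Re (m z ((2^-1%:C *: g + 2^-1%:C *: - h) z)) <=
      2^-1 * (d / 2).
    rewrite (le_trans _ (ler_wpM2l (ltW half0) mgh))//.
    rewrite mulr_sumr ler_sum// => z _.
    rewrite (_ : wspace_fun _ z = 2^-1%:C *: g z + 2^-1%:C *: - h z)//.
    rewrite ReB ler_wpM2l//.
    exact: Re_le_rnorm.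
  rewrite /=; lra.
have e2 : 0 < e / 2 by rewrite divr_gt0.
have i1 := near_re Phi _ e2; have i2 := near_re (- Phi) _ e2.
have i3 := near_re ('i%C *: Phi) _ e2.
have i4 := near_re (- ('i%C *: Phi)) _ e2.
apply: filterS2 (filterI i1 i2) (filterI i3 i4) => h [h1 h2] [h3 h4].
rewrite (splitr e); apply: cplx_le_rotations => //.
- by rewrite opprD.
- by rewrite scalerBr.
- by rewrite scalerBr opprD.
Qed.

Lemma scalarized_in_weak_compact (X : completeNormedModType R[i]) (A : set E) :
  reflexive_space X -> ball_compact E -> compact A -> symmetric_convex A ->
  compact (scalarized_in A : set (weak (wspace E X))).
Proof.
move=> rX bE cA sA; rewrite compact_ultra => F FU FA.
have [P Pl] : exists P : dual X -> wspace E X -> E,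
    forall l h, af_fun E (P l h) = l \o h.
  have [P PE] := choice (fun lh : dual X * wspace E X => wspace_pull lh.2 lh.1).
  by exists (fun l h => P (l, h)) => l h; exact: PE (l, h).
(* An ultrafilter converges in the compact set [A]; 0 is a placeholder for functionals outside the
   unit ball. *)
have UE l : exists u : E, dual_norm l <= 1 -> A u /\ P l @ F --> u.
  have [l1|] := leP (dual_norm l) 1; last by exists 0.
  have PU : UltraFilter (P l @ F) by exact: fmap_ultra.
  move: cA; rewrite compact_ultra => /(_ _ PU)[|u [Au uF]].
    apply: (@filterS _ F _ (scalarized_in A) _ _ FA) => h Kh.
    have [u Au ul] := Kh l l1.
    by rewrite /= (_ : P l h = u)//; apply: (@af_inj _ E); rewrite Pl.
  by exists u.
have [U UP] := choice UE.
have FP : ProperFilter F by exact: ultra_proper.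
have [M AM] := compact_locally_bounded cA (fun u _ => rnorm_locally_bounded u).
have evU l z : dual_norm l <= 1 ->
    (fun h : wspace E X => l (h z) : Cplx R) @ F -->
    (af_fun E (U l) z : Cplx R).
  move=> /UP[_ /cvg_rnormP PU]; apply/cvg_rnormP => e e0.
  have [c c0 cE] := ball_compact_eval z bE.
  have ec : 0 < e / (c + 1) by rewrite divr_gt0// ltr_wpDl.
  apply: filterS (PU _ ec) => h hU.
  rewrite -[l (h z)]/((l \o h) z) -Pl -af_funB (le_lt_trans (cE _))//.
  rewrite (le_lt_trans (ler_wpM2l c0 (ltW hU)))//.
  by rewrite mulrCA gtr_pMr// ltr_pdivrMr ?mul1r ?ltrDl// ltr_wpDl.
(* Linearity of the limit in [l] makes sense on the whole dual, so functionals outside the unit ball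
   are reached by scaling. *)
have lim z (l : dual X) : exists c : Cplx R,
    (fun h : wspace E X => l (h z) : Cplx R) @ F --> c.
  have [l0|l0] := eqVneq (dual_norm l) 0.
    exists 0; rewrite (dual_norm_eq0 l0).
    exact: cvg_cst.
  have lp : 0 < dual_norm l by rewrite lt_neqAle eq_sym l0 dual_norm_ge0.
  have l1 : dual_norm ((dual_norm l)^-1%:C *: l) <= 1.
    by rewrite -rnorm_dual rnormZr rnorm_dual gtr0_norm ?invr_gt0// mulVf.
  have := evU _ z l1.
  set c := af_fun E _ z => cc; exists ((dual_norm l)%:C *: c).
  rewrite (_ : (fun h => _) = (dual_norm l)%:C \*:
      (fun h : wspace E X => ((dual_norm l)^-1%:C *: l) (h z) : Cplx R)).
    exact: cvgZl_tmp cc.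
  apply/funext => h /=.
  rewrite -[RHS]/((dual_norm l)%:C *: ((dual_norm l)^-1%:C *: l (h z))).
  by rewrite real_scalerA mulfV// real_scale1r.
have [Psi PsiP] : exists Psi : disc R -> dual X -> Cplx R,
    forall z (l : dual X),
    (fun h : wspace E X => l (h z) : Cplx R) @ F --> Psi z l.
  have [Q QP] := choice (fun zl : disc R * dual X => lim zl.1 zl.2).
  by exists (fun z l => Q (z, l)) => z l; exact: QP (z, l).
have lim_uniq (f : wspace E X -> Cplx R) (a b : Cplx R) :
    f @ F --> a -> f @ F --> b -> a = b.
  by move=> fa fb; refine (cvg_unique (@norm_hausdorff _ (Cplx R)) fa fb).
have PsiU z l : dual_norm l <= 1 -> Psi z l = af_fun E (U l) z.
  by move=> l1; apply: lim_uniq (PsiP z l) (evU l z l1).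
have Psil z : linear (Psi z).
  move=> a l m; apply: lim_uniq (PsiP z _) _.
  apply: cvgD (PsiP z m); exact: cvgZl_tmp (PsiP z l).
(* The limit at [z] is a functional on the dual of [X], bounded by the evaluation constant times the
   bound [M] of [A]; reflexivity represents it by a point. *)
have gE z : exists v : X, forall l : dual X, Psi z l = l v.
  pose L : {linear dual X -> Cplx R} :=
    HB.pack (Psi z) (GRing.isLinear.Build _ _ _ _ (Psi z) (Psil z)).
  have [c c0 cE] := ball_compact_eval z bE.
  have LM l : rnorm (L l) <= c * M * rnorm l.
    apply: bounded_on_ball => {}l l1; rewrite -[L l]/(Psi z l) PsiU//.
    by rewrite (le_trans (cE _))// ler_wpM2l// AM//; exact: (UP l l1).1.
  exact: (rX (Dual (dual_predP (Psil z) LM))).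
have [g Pg] := choice gE.
have lg (l : dual X) : dual_norm l <= 1 -> exists2 u, A u & af_fun E u = l \o g.
  move=> l1; exists (U l); first exact: (UP l l1).1.
  by apply/funext => z; rewrite -PsiU// Pg.
have gW : g \in @wspace_pred R E X.
  apply/asboolP; split; first exact: analytic_of_compact_scalarization lg.
  apply: (@le_lt_trans _ _ (M%:E)%E); last exact: ltry.
  by apply: weak_norm_le => l /lg[u Au ul]; exists u => //; exact: AM.
exists (WSpace gW); split; first exact: lg.
apply: (@scalarized_in_weak_cvg X A F (WSpace gW)) => // z l e e0.
have /cvg_rnormP/(_ _ e0) := PsiP z l.
apply: filterS => h; rewrite Pg; exact: ltW.
Qed.

(** The weak topology is Hausdorff, so the compact superset makes [B] precompact. *)
Lemma precompact_scalarized (X : completeNormedModType R[i]) (A : set E)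
    (B : set (wspace E X)) :
  reflexive_space X -> ball_compact E -> compact A -> symmetric_convex A ->
  B `<=` scalarized_in A -> precompact (B : set (weak (wspace E X))).
Proof.
move=> rX bE cA sA BA; apply: (@precompact_subset (weak (wspace E X)) B _ BA).
apply: compact_precompact; first exact: weak_hausdorff.
exact: scalarized_in_weak_compact.
Qed.

End WeakCompactness.

(** * Convexity of the closed image of the ball, and the two assertions *)

Lemma symmetric_convex_closure (R : realType) (V : normedModType R[i])
    (A : set V) : symmetric_convex A -> symmetric_convex (closure A).
Proof.
move=> [AN AC]; split=> [x|s t x y s0 t0 st].
  move=> /closure_rnormP cx; apply/closure_rnormP => e e0.
  have [y Ay xy] := cx e e0; exists (- y); first exact: AN.
  by rewrite -opprD rnormN.
move=> /closure_rnormP cx /closure_rnormP cy; apply/closure_rnormP => e e0.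
have [x' Ax xx'] := cx e e0; have [y' Ay yy'] := cy e e0.
exists (s%:C *: x' + t%:C *: y'); first exact: AC.
rewrite opprD addrACA -!scalerBr (le_lt_trans (rnormD _ _))//.
rewrite !rnormZr !gtr0_norm// -[e]mul1r -st mulrDl.
by rewrite ltrD// ltr_pM2l.
Qed.

Lemma symmetric_convex_image_ball (R : realType) (V W : normedModType R[i])
    (T : {linear V -> W}) : symmetric_convex (T @` unit_ball).
Proof.
split=> [_ [x /unit_ballE x1 <-]|
  s t _ _ s0 t0 st [x /unit_ballE x1 <-] [y /unit_ballE y1 <-]].
  by exists (- x); rewrite ?linearN//; apply/unit_ballE; rewrite rnormN.
exists (s%:C *: x + t%:C *: y); last by rewrite linearD !linearZ.
apply/unit_ballE; rewrite (le_trans (rnormD _ _))// !rnormZr !gtr0_norm//.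
by rewrite -st lerD// ler_piMr// ltW.
Qed.

Theorem proposition3 (R : realType) (psi : disc R -> Cplx R)
    (phi : disc R -> disc R) (X : completeNormedModType (complex R))
    (E1 E2 : analyticBanachSpace R) :
  analytic psi ->
  analytic (fun z => val (phi z) : Cplx R) ->
  has_constants E1 -> ball_compact E1 ->
  has_constants E2 -> ball_compact E2 ->
  (acts_as bounded_operator (weighted_composition psi phi)
     (af_fun E1) (af_fun E2) ->
   acts_as bounded_operator (weighted_composition psi phi)
     (@wspace_fun R E1 X) (@wspace_fun R E2 X))
  /\
  (reflexive_space X ->
   acts_as compact_operator (weighted_composition psi phi)
     (af_fun E1) (af_fun E2) ->
   acts_as weakly_compact_operator (weighted_composition psi phi)
     (@wspace_fun R E1 X) (@wspace_fun R E2 X)).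
Proof.
move=> apsi aphi _ _ _ bE2.
split=> [[T [TW /bounded_operatorP[M M0 TM]]]|rX [T [TW cT]]].
  have [S [SW SM]] := weighted_composition_wspace X apsi aphi TW M0 TM.
  by exists S; split => //; apply/bounded_operatorP; exists M.
(* Compactness supplies the bound from which [S] is constructed. *)
have /bounded_operatorP[M M0 TM] := compact_operator_bounded cT.
have [S [SW SM]] := weighted_composition_wspace X apsi aphi TW M0 TM.
exists S; split => //.
move: cT; rewrite /compact_operator precompactE => cT.
(* The compact set is the closure of the image of the unit ball under [T]. *)
apply: precompact_scalarized rX bE2 cT _ _.
  exact/symmetric_convex_closure/symmetric_convex_image_ball.
move=> _ [f /unit_ballE f1 <-] l l1.
have [k kl kf] := wspace_pull_ball f l1.
exists (T k).
  apply: subset_closure; exists k => //; apply/unit_ballE.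
  exact: le_trans f1.
rewrite TW SW kl; apply/funext => z.
rewrite -[LHS]/(psi z *: l (f (phi z))).
by rewrite -[RHS]/(l (psi z *: f (phi z))) linearZ.
Qed.
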